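(* Let $\alpha>0$ and $\nu\in\mathbb{C}$. On the half-plane ${\rm Re}(z)>0$ the function $u(z)=K_{\alpha,\nu}(z)$ satisfies the integro-differential equation $$\left(\alpha^2\, z\frac{d}{dz}\,z\frac{d}{dz}\right)\left[u(z)-I_-^{2/\alpha}u(z)\right]=\nu^2 u(z)-\alpha z\frac{d}{dz}I_-^{2/\alpha}u(z).$$
   Context: For $\alpha>0$, $\nu\in\mathbb{C}$ and ${\rm Re}(z)>0$, $$K_{\alpha,\nu}(z)=\int_0^\infty e^{-z\cosh^\alpha u}\cosh(\nu u)\,du .$$ For $\beta>0$, $I_-^\beta$ denotes the right-handed Riemann-Liouville fractional integral $$I_-^\beta u(z)=\frac{z^\beta}{\Gamma(\beta)}\int_1^\infty (x-1)^{\beta-1}u(zx)\,dx ,$$ with the principal branch of $z^\beta$. The operator $z\frac{d}{dz}z\frac{d}{dz}$ means applying $z\frac{d}{dz}$ twice. *)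

(* Defs.v *)
From mathcomp Require Import all_boot all_order all_algebra.
From mathcomp Require Import complex.
From mathcomp Require Import all_classical all_reals all_analysis.
Set Implicit Arguments.
Unset Strict Implicit.
Unset Printing Implicit Defensive.
Import Order.TTheory GRing.Theory Num.Theory.
Import numFieldNormedType.Exports.
Local Open Scope classical_set_scope.
Local Open Scope ring_scope.
Local Open Scope complex_scope.

Section ComplexFunctions.
Context {R : realType}.
Implicit Types (z nu : R[i]) (a b u x t : R) (D : set R).

Definition expC z : R[i] :=
  (expR (complex.Re z) * cos (complex.Im z)) +i*
  (expR (complex.Re z) * sin (complex.Im z)).

Definition coshC z : R[i] := (expC z + expC (- z)) / 2.

Definition coshR u : R := (expR u + expR (- u)) / 2.

Definition absC z : R := complex.Re `|z|.

(* Principal argument, with values in ]-pi, pi]; meaningful for z != 0. *)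
Definition argC z : R :=
  if 0 <= complex.Im z then acos (complex.Re z / absC z)
  else - acos (complex.Re z / absC z).

Definition lnC z : R[i] := ln (absC z) +i* argC z.

(* Principal branch of z ^ b for a real exponent b; meaningful for z != 0. *)
Definition powC z b : R[i] := expC (b%:C * lnC z).

Definition integrableC D (f : R -> R[i]) : Prop :=
  (@lebesgue_measure R).-integrable D (fun x => (complex.Re (f x))%:E) /\
  (@lebesgue_measure R).-integrable D (fun x => (complex.Im (f x))%:E).

(* Meaningful only when integrableC D f holds. *)
Definition integralC D (f : R -> R[i]) : R[i] :=
  (\int[lebesgue_measure]_(x in D) complex.Re (f x)) +i*
  (\int[lebesgue_measure]_(x in D) complex.Im (f x)).

Definition Gamma b : R :=
  \int[lebesgue_measure]_(t in `]0, +oo[) (t `^ (b - 1) * expR (- t)).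

Definition K_integrand a nu z u : R[i] :=
  expC (- z * (coshR u `^ a)%:C) * coshC (nu * u%:C).

Definition K a nu z : R[i] := integralC `[0, +oo[ (K_integrand a nu z).

Definition RL_integrand b (f : R[i] -> R[i]) z x : R[i] :=
  ((x - 1) `^ (b - 1))%:C * f (z * x%:C).

(* Right-handed Riemann-Liouville fractional integral of order b > 0.  The
   endpoint 1, where the kernel is singular if b < 1, is left out of the
   domain. *)
Definition RL b (f : R[i] -> R[i]) z : R[i] :=
  powC z b / (Gamma b)%:C * integralC `]1, +oo[ (RL_integrand b f z).

(* R[i]^o is R[i] as a normed module over itself: the increment h in
   h^-1 *: (f (h + z) - f z) ranges over R[i], so this is complex
   differentiability. *)
Definition differentiableC (f : R[i] -> R[i]) z : Prop :=
  derivable (f : R[i]^o -> R[i]^o) z 1.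

(* The operator z d/dz; meaningful where differentiableC f z holds. *)
Definition zD (f : R[i] -> R[i]) z : R[i] :=
  z * 'D_1 (f : R[i]^o -> R[i]^o) z.

End ComplexFunctions.

(* Main.v *)
Require Import Defs.
From mathcomp Require Import all_boot all_order all_algebra.
From mathcomp Require Import complex.
From mathcomp Require Import ring lra.
From mathcomp Require Import all_classical all_reals all_analysis.
From mathcomp Require Import measurable_realfun.
Set Implicit Arguments.
Unset Strict Implicit.
Unset Printing Implicit Defensive.
Import Order.TTheory GRing.Theory Num.Theory.
Import numFieldNormedType.Exports.
Local Open Scope classical_set_scope.
Local Open Scope ring_scope.
Local Open Scope complex_scope.

(** With [c t = cosh t ^ alpha], the identity
    [Gamma b * s ^ (-b) = int_0^oo y ^ (b-1) e^(-s y) dy] (for complex [s]) and Fubini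
    turn [I_-^(2/alpha)] into multiplication of the integrand of [K] by
    [c ^ (-2/alpha) = cosh ^ (-2)], so that [u - I_-^(2/alpha) u] is the same integral
    with the extra weight [tanh ^ 2].  On [E = e^(-z c t)] the operator [z d/dz]
    satisfies [alpha * tanh t * (z d/dz) E = dE/dt], whence
    [alpha^2 tanh^2 t (z d/dz)^2 E = E'' - alpha cosh^(-2) t (z d/dz) E]; integrating
    against [cosh (nu t)] by parts twice replaces [E''] by [nu^2 E].

    Integrals [int e^(-z c) phi] are differentiated in [z] by the second-order bound
    [|e^w - 1 - w| <= 2 |w|^2 e^|w|], which gives complex derivatives with no appeal
    to dominated convergence. *)

(** * Complex numbers and complex-valued integrals *)

Section ComplexExp.
Context {R : realType}.
Implicit Types (z w : R[i]) (a b x : R).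
Local Notation Re := complex.Re.
Local Notation Im := complex.Im.

(** Converting z d/dz into d/dt by dividing by alpha tanh t breaks down at t = 0. The weight tanh ^
    2 carried by u - I u is exactly what makes the division unnecessary, and this is why the
    second-order operator acts on u - I u; the leftover cosh ^ (-2) term integrates to the
    first-order term in I u on the right.

    For non-real s the Gamma integral is not a mere rescaling of the real one. Instead both sides,
    as functions of s, are followed along a curve from 1 to s in the half-plane, where the integral
    G satisfies s G' = - b G. The logarithm of the curve is a segment, so the principal branch
    enters with no choice to make.

    When alpha > 2 the order b = 2/alpha is below 1 and y ^ (b-1) is unbounded at 0. Hence the
    calculus on the half-line is done on the open one, with only limits at the two ends.

    Convergence depends on z through Re z alone. The recurring device is to split e^(-Re z c) into
    two halves: one absorbs powers of c, the other keeps the integral finite. *)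

Lemma complex_eqP z w : Re z = Re w -> Im z = Im w -> z = w.
Proof. by case: z => a b; case: w => c d /= -> ->. Qed.

Lemma Re_add z w : Re (z + w) = Re z + Re w. Proof. by case: z; case: w. Qed.
Lemma Im_add z w : Im (z + w) = Im z + Im w. Proof. by case: z; case: w. Qed.
Lemma Re_opp z : Re (- z) = - Re z. Proof. by case: z. Qed.
Lemma Im_opp z : Im (- z) = - Im z. Proof. by case: z. Qed.
Lemma Re_mul z w : Re (z * w) = Re z * Re w - Im z * Im w.
Proof. by case: z; case: w. Qed.
Lemma Im_mul z w : Im (z * w) = Re z * Im w + Im z * Re w.
Proof. by case: z => a b; case: w => c d. Qed.
Lemma Re_real x : Re x%:C = x. Proof. by []. Qed.
Lemma Im_real x : Im x%:C = 0. Proof. by []. Qed.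
Lemma Re_expC z : Re (expC z) = expR (Re z) * cos (Im z). Proof. by []. Qed.
Lemma Im_expC z : Im (expC z) = expR (Re z) * sin (Im z). Proof. by []. Qed.
Definition ReImE := (Re_add, Im_add, Re_opp, Im_opp, Re_mul, Im_mul, Re_real,
  Im_real, Re_expC, Im_expC).

Lemma half_realC : (2^-1 : R[i]) = (2^-1)%:C.
Proof. by rewrite fmorphV rmorph_nat. Qed.

Lemma absCE z : absC z = Num.sqrt (Re z ^+ 2 + Im z ^+ 2).
Proof. by rewrite /absC normc_def. Qed.

Lemma normC_absC z : `|z| = (absC z)%:C.
Proof. by rewrite absCE normc_def. Qed.

Lemma absC_ge0 z : 0 <= absC z. Proof. by rewrite absCE sqrtr_ge0. Qed.

Lemma absC0 : absC (0 : R[i]) = 0. Proof. by rewrite /absC normr0. Qed.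

Lemma absC_sqr z : absC z ^+ 2 = Re z ^+ 2 + Im z ^+ 2.
Proof. by rewrite absCE sqr_sqrtr// addr_ge0 ?sqr_ge0. Qed.

Lemma absCM z w : absC (z * w) = absC z * absC w.
Proof. by rewrite {1}/absC normrM !normC_absC Re_mul /= mulr0 subr0. Qed.

Lemma absCD z w : absC (z + w) <= absC z + absC w.
Proof.
have := ler_normD z w.
by rewrite !normC_absC -rmorphD lecR.
Qed.

Lemma absCN z : absC (- z) = absC z. Proof. by rewrite /absC normrN. Qed.

Lemma absC_real x : absC x%:C = `|x|.
Proof. by rewrite absCE /= expr0n addr0 sqrtr_sqr. Qed.

Lemma absC_half z : absC (z / 2) = absC z / 2.
Proof. by rewrite half_realC absCM absC_real ger0_norm. Qed.

Lemma ler_Re_absC z : `|Re z| <= absC z.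
Proof. by rewrite absCE -sqrtr_sqr ler_wsqrtr// lerDl sqr_ge0. Qed.

Lemma ler_Im_absC z : `|Im z| <= absC z.
Proof. by rewrite absCE -sqrtr_sqr ler_wsqrtr// lerDr sqr_ge0. Qed.

Lemma absC_ler_ReIm z : absC z <= `|Re z| + `|Im z|.
Proof.
rewrite absCE -[leRHS]ger0_norm ?addr_ge0// -sqrtr_sqr ler_wsqrtr//.
rewrite sqrrD !real_normK ?num_real// -addrA addrCA lerDr.
by rewrite mulrn_wge0// mulr_ge0.
Qed.

Lemma absC_gt0 z : 0 < Re z -> 0 < absC z.
Proof.
by move=> h; rewrite (lt_le_trans h)// (le_trans (ler_norm _))// ler_Re_absC.
Qed.

Lemma expCD z w : expC (z + w) = expC z * expC w.
Proof.
apply: complex_eqP; rewrite ?Re_mul ?Im_mul /= Re_add Im_add expRD ?cosD ?sinD; ring.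
Qed.

Lemma expC_real x : expC x%:C = (expR x)%:C.
Proof. by apply: complex_eqP; rewrite /= ?cos0 ?sin0 ?mulr1 ?mulr0. Qed.

Lemma expC0 : expC (0 : R[i]) = 1.
Proof. by rewrite (_ : 0 = 0%:C)// expC_real expR0. Qed.

Lemma absC_expC z : absC (expC z) = expR (Re z).
Proof.
by rewrite absCE /= !exprMn -mulrDr cos2Dsin2 mulr1 sqrtr_sqr ger0_norm.
Qed.

Lemma absC_coshC_le z : absC (coshC z) <= expR `|Re z|.
Proof.
rewrite /coshC absC_half ler_pdivrMr// (le_trans (absCD _ _))// !absC_expC.
rewrite Re_opp mulrDr mulr1 lerD// ler_expR ?ler_norm//.
by rewrite (le_trans (ler_norm _))// normrN.
Qed.

Definition sinhC z : R[i] := (expC z - expC (- z)) / 2.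

Lemma absC_sinhC_le z : absC (sinhC z) <= expR `|Re z|.
Proof.
rewrite /sinhC absC_half ler_pdivrMr// (le_trans (absCD _ _))//.
rewrite absCN !absC_expC Re_opp mulrDr mulr1 lerD// ler_expR ?ler_norm//.
by rewrite (le_trans (ler_norm _))// normrN.
Qed.

End ComplexExp.

(** * Measurability of complex-valued functions, by components *)

Section MeasurableC.
Context {R : realType} d (T : measurableType d).
Implicit Types (f g : T -> R[i]) (h : T -> R).

Definition cmeasurable f := measurable_fun setT (fun x => complex.Re (f x)) /\
  measurable_fun setT (fun x => complex.Im (f x)).

Lemma cmeasurable_real h : measurable_fun setT h -> cmeasurable (fun x => (h x)%:C).
Proof. by move=> mh; split => //=; exact: measurable_cst. Qed.

Lemma cmeasurable_cst (k : R[i]) : cmeasurable (fun=> k).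
Proof. by split; exact: measurable_cst. Qed.

Lemma cmeasurableD f g : cmeasurable f -> cmeasurable g ->
  cmeasurable (fun x => f x + g x).
Proof.
move=> [rf jf] [rg jg]; split.
  by under eq_fun do rewrite Re_add; exact: measurable_funD.
by under eq_fun do rewrite Im_add; exact: measurable_funD.
Qed.

Lemma cmeasurableM f g : cmeasurable f -> cmeasurable g ->
  cmeasurable (fun x => f x * g x).
Proof.
move=> [rf jf] [rg jg]; split.
  under eq_fun do rewrite Re_mul.
  by apply: measurable_funB; exact: measurable_funM.
under eq_fun do rewrite Im_mul.
by apply: measurable_funD; exact: measurable_funM.
Qed.

Lemma cmeasurable_expC f : cmeasurable f -> cmeasurable (fun x => expC (f x)).
Proof.
move=> [rf jf]; split => /=; apply: measurable_funM.
- exact: measurableT_comp (@measurable_expR R) rf.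
- apply: (@measurableT_comp _ _ _ _ _ _ cos _ _ _ jf).
  by apply: continuous_measurable_fun; exact: continuous_cos.
- exact: measurableT_comp (@measurable_expR R) rf.
- apply: (@measurableT_comp _ _ _ _ _ _ sin _ _ _ jf).
  by apply: continuous_measurable_fun; exact: continuous_sin.
Qed.

Lemma cmeasurable_absC f : cmeasurable f -> measurable_fun setT (fun x => absC (f x)).
Proof.
move=> [rf jf]; under eq_fun do rewrite absCE.
have ms : measurable_fun setT (@Num.sqrt R).
  by apply: continuous_measurable_fun; exact: sqrt_continuous.
apply: (measurableT_comp ms).
by apply: measurable_funD; exact: measurable_funX.
Qed.

End MeasurableC.

(** * Linearity and bounds for integrals of complex-valued functions *)

Section IntegralC.
Context {R : realType}.
Local Notation mu := (@lebesgue_measure R).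
Variables (D : set R) (mD : measurable D).
Implicit Types (f g : R -> R[i]) (h : R -> R).

Lemma le_integrable_real (g h : R -> R) : measurable_fun D g ->
  (forall x, D x -> `|g x| <= h x) -> mu.-integrable D (EFin \o h) ->
  mu.-integrable D (EFin \o g).
Proof.
move=> mg gh ih; apply: (@le_integrable _ _ _ mu D mD _ _ _ _ ih).
  exact/measurable_EFinP.
by move=> x Dx /=; rewrite lee_fin (le_trans (gh _ Dx))// ler_norm.
Qed.

Lemma le_integrableC f h : cmeasurable f -> mu.-integrable D (EFin \o h) ->
  (forall x, D x -> absC (f x) <= h x) -> integrableC D f.
Proof.
move=> [rf jf] ih fh; split; apply: le_integrable_real ih => [|x Dx].
- exact: measurable_funTS.
- exact: le_trans (ler_Re_absC _) (fh _ Dx).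
- exact: measurable_funTS.
- exact: le_trans (ler_Im_absC _) (fh _ Dx).
Qed.

Lemma eq_integralC f g : (forall x, D x -> f x = g x) ->
  integralC D f = integralC D g.
Proof.
by move=> fg; congr (_ +i* _); apply: eq_Rintegral => x /[!inE] Dx; rewrite fg.
Qed.

Lemma integralC_real h : integralC D (fun x => (h x)%:C) = (\int[mu]_(x in D) h x)%:C.
Proof.
apply: complex_eqP => //=.
by rewrite /Rintegral (@integral0 _ _ _ mu D).
Qed.

Lemma integralCD f g : integrableC D f -> integrableC D g ->
  integralC D (fun x => f x + g x) = integralC D f + integralC D g.
Proof.
move=> [rf jf] [rg jg]; apply: complex_eqP; rewrite ?Re_add ?Im_add /=.
  by under eq_Rintegral do rewrite Re_add; exact: RintegralD.
by under eq_Rintegral do rewrite Im_add; exact: RintegralD.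
Qed.

Lemma integrableCD f g : integrableC D f -> integrableC D g ->
  integrableC D (fun x => f x + g x).
Proof.
move=> [rf jf] [rg jg]; split.
  by under eq_fun do rewrite Re_add EFinD; exact: integrableD.
by under eq_fun do rewrite Im_add EFinD; exact: integrableD.
Qed.

Lemma integrableCZ f (k : R[i]) : integrableC D f ->
  integrableC D (fun x => k * f x).
Proof.
move=> [rf jf]; split.
  under eq_fun do rewrite Re_mul EFinB !EFinM.
  by apply: integrableB => //; exact: integrableZl.
under eq_fun do rewrite Im_mul EFinD !EFinM.
by apply: integrableD => //; exact: integrableZl.
Qed.

Lemma integralCZ f (k : R[i]) : integrableC D f ->
  integralC D (fun x => k * f x) = k * integralC D f.
Proof.
move=> [rf jf]; apply: complex_eqP; rewrite ?Re_mul ?Im_mul /=.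
  under eq_Rintegral do rewrite Re_mul.
  rewrite RintegralB//; last 2 first.
    exact: (@integrableZl _ _ _ mu D mD _ _ rf).
    exact: (@integrableZl _ _ _ mu D mD _ _ jf).
  by rewrite !RintegralZl.
under eq_Rintegral do rewrite Im_mul.
rewrite RintegralD//; last 2 first.
  exact: (@integrableZl _ _ _ mu D mD _ _ jf).
  exact: (@integrableZl _ _ _ mu D mD _ _ rf).
by rewrite !RintegralZl.
Qed.

(** The factor 2 comes from bounding the real and imaginary parts separately. *)
Lemma absC_integralC_le f h : integrableC D f -> mu.-integrable D (EFin \o h) ->
  (forall x, D x -> absC (f x) <= h x) ->
  absC (integralC D f) <= 2 * \int[mu]_(x in D) h x.
Proof.
move=> [rf jf] ih fh; rewrite (le_trans (absC_ler_ReIm _))//= mulr_natl mulr2n.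
apply: lerD; apply: (le_trans (@le_normr_Rintegral _ _ _ mu D _ mD _)) => //;
    apply: le_Rintegral => //.
- exact: (integrable_norm rf).
- by move=> x Dx; rewrite (le_trans (ler_Re_absC _))// fh.
- exact: (integrable_norm jf).
- by move=> x Dx; rewrite (le_trans (ler_Im_absC _))// fh.
Qed.

End IntegralC.

(** * Differentiation of Laplace integrals *)

Section TaylorExp.
Context {R : realType}.
Implicit Types (z w k : R[i]) (p : R).
Local Notation Re := complex.Re.
Local Notation Im := complex.Im.

Lemma is_derive_Re_expC_line k w p :
  is_derive p (1 : R) (fun q : R => Re (k * expC (q%:C * w)))
    (Re (k * w * expC (p%:C * w))).
Proof.
have -> : (fun q : R => Re (k * expC (q%:C * w))) =
    (fun q => Re k * (expR (q * Re w) * cos (q * Im w))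
            - Im k * (expR (q * Re w) * sin (q * Im w))).
  by apply/funext => q; rewrite !ReImE !mul0r subr0 addr0.
apply: is_derive_eq; rewrite !ReImE !mul0r subr0 addr0.
rewrite /GRing.scale /=; ring.
Qed.

(** The mean value theorem holds for real functions only, so it is applied twice to the real part of
    k e^(q w) along the segment from 0 to w: once with multiplier k on [0, 1], then with multiplier
    k w on [0, y]. The free multiplier k serves this iteration and also recovers the imaginary part,
    with k = -i. *)
Lemma Re_expC_taylor k w :
  `|Re (k * (expC w - 1 - w))| <= absC k * absC w ^+ 2 * expR (absC w).
Proof.
have mvt k' (x : R) : 0 <= x -> exists2 y, 0 <= y <= x &
    Re (k' * expC (x%:C * w)) - Re k' = x * Re (k' * w * expC (y%:C * w)).
  move=> x0.
  have [| |y /[!in_itv]/= yx] := @MVT_segment R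
    (fun q : R => Re (k' * expC (q%:C * w)))
    (fun p => Re (k' * w * expC (p%:C * w))) 0 x x0.
  - by move=> t _; exact: is_derive_Re_expC_line.
  - apply: derivable_within_continuous => t _.
    by have [] := is_derive_Re_expC_line k' w t.
  rewrite mul0r expC0 mulr1 subr0 => e; exists y; rewrite ?yx// e; ring.
have [y /andP[y0 y1] e1] := mvt k 1 ler01.
have [x /andP[x0 xy] e2] := mvt (k * w) y y0.
rewrite mul1r mul1r in e1.
have -> : Re (k * (expC w - 1 - w)) = y * Re (k * w * w * expC (x%:C * w)).
  by rewrite -e2 -e1 !mulrBr !Re_add !Re_opp mulr1.
rewrite normrM (ger0_norm y0) -[leRHS]mul1r ler_pM//.
rewrite (le_trans (ler_Re_absC _))// !absCM absC_expC. rewrite expr2 !mulrA.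
rewrite ler_wpM2l ?mulr_ge0 ?absC_ge0// ler_expR !ReImE mul0r subr0.
rewrite (le_trans (ler_norm _))// normrM (ger0_norm x0).
rewrite -[leRHS]mul1r ler_pM ?ler_Re_absC//.
exact: le_trans y1.
Qed.

Lemma absC_expC_taylor w :
  absC (expC w - 1 - w) <= 2 * (absC w ^+ 2 * expR (absC w)).
Proof.
rewrite (le_trans (absC_ler_ReIm _))// mulr_natl mulr2n lerD//.
  have := Re_expC_taylor 1 w; rewrite mul1r.
  by rewrite [absC 1](_ : _ = 1) ?mul1r// /absC normr1.
have := Re_expC_taylor (- 'i) w.
rewrite absCN [absC 'i](_ : _ = 1) ?mul1r; last first.
  by rewrite absCE /= expr0n expr1n add0r sqrtr1.
by rewrite mulNr Re_opp Re_mul /= mul0r mul1r sub0r opprK.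
Qed.

(** Stated over an arbitrary numeric field so that one proof serves complex derivatives (K = R[i])
    and derivatives in a real variable (K = R). *)
Lemma is_derive_quadratic (K : numFieldType) (f : K^o -> K^o) (z l : K^o) (M e : K) :
  0 <= M -> 0 < e ->
  (forall h : K, `|h| < e -> `|f (z + h) - f z - h * l| <= M * `|h| ^+ 2) ->
  is_derive z 1 f l.
Proof.
move=> M0 e0 fM.
have H : (h^-1 *: (f (h *: 1 + z) - f z)) @[h --> (0 : K^o)^'] --> l.
  apply/cvgrPdist_le => /= r r0.
  have M1 : 0 < M + 1 by rewrite ltr_wpDl.
  near=> h.
  have h0 : h != (0 : K^o).
    near: h; exact: (@nbhs_dnbhs_neq K^o 0).
  have he : `|h| < e by near: h; exact: (@dnbhs0_lt _ K^o).
  have hr : `|h| < r / (M + 1).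
    by near: h; apply: (@dnbhs0_lt _ K^o); rewrite divr_gt0.
  have -> : l - h^-1 *: (f (h *: 1 + z) - f z) =
      - (h^-1 * (f (z + h) - f z - h * l)).
    by rewrite [h *: _]mulr1 [h + z]addrC mulrBr mulKf// opprB.
  rewrite normrN normrM normfV ler_pdivrMl ?normr_gt0//.
  rewrite (le_trans (fM _ he))// expr2 mulrCA ler_wpM2l// mulrC.
  move: hr; rewrite ltr_pdivlMr// => /ltW; apply: le_trans.
  by rewrite ler_wpM2l// lerDl.
by split; [apply/cvg_ex; exists l|exact/cvg_lim].
Unshelve. all: by end_near. Qed.

Lemma is_deriveC_quadratic (f : R[i] -> R[i]) z (l : R[i]) (M e : R) :
  0 <= M -> 0 < e ->
  (forall h, absC h < e -> absC (f (z + h) - f z - h * l) <= M * absC h ^+ 2) ->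
  is_derive (z : R[i]^o) 1 (f : R[i]^o -> R[i]^o) (l : R[i]^o).
Proof.
move=> M0 e0 fM; apply: (@is_derive_quadratic _ _ _ _ M%:C e%:C).
- by rewrite lecR.
- by rewrite ltcR.
- move=> h; rewrite !normC_absC ltcR => /fM; rewrite -lecR rmorphM rmorphXn.
  exact.
Qed.

End TaylorExp.

(** * Laplace integrals with exponent -z c(x) and weight phi *)

Section Laplace.
Context {R : realType}.
Local Notation mu := (@lebesgue_measure R).
Local Notation Re := complex.Re.
Local Notation Im := complex.Im.
Implicit Types (D : set R) (c : R -> R) (phi psi : R -> R[i]) (z : R[i]).

Definition laplace D c phi z : R[i] :=
  integralC D (fun x => expC (- z * (c x)%:C) * phi x).

(** Integrability is demanded for every s > 0, not just at one abscissa: this leaves room to give up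
    half of the decay, and makes the condition stable under multiplication of phi by c, hence under
    differentiation in z. *)
Definition laplace_weight D c phi : Prop :=
  [/\ measurable D, measurable_fun setT c, cmeasurable phi,
      forall x, D x -> 0 <= c x &
      forall s : R, 0 < s ->
        mu.-integrable D (fun x => (expR (- s * c x) * absC (phi x))%:E)].

Lemma absC_laplace_kernel c phi z x :
  absC (expC (- z * (c x)%:C) * phi x) = expR (- Re z * c x) * absC (phi x).
Proof. by rewrite absCM absC_expC !ReImE mulr0 subr0. Qed.

Lemma cmeasurable_laplace_kernel c phi z : measurable_fun setT c ->
  cmeasurable phi -> cmeasurable (fun x => expC (- z * (c x)%:C) * phi x).
Proof.
move=> mc mphi; apply: cmeasurableM => //; apply: cmeasurable_expC.
by apply: cmeasurableM; [exact: cmeasurable_cst|exact: cmeasurable_real].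
Qed.

Lemma laplace_integrable D c phi z : laplace_weight D c phi -> 0 < Re z ->
  integrableC D (fun x => expC (- z * (c x)%:C) * phi x).
Proof.
move=> [mD mc mphi c0 ci] z0; apply: (le_integrableC mD _ (ci _ z0)).
  exact: cmeasurable_laplace_kernel.
by move=> x _; rewrite absC_laplace_kernel.
Qed.

Lemma laplace_weight_le D c phi psi (M : R) : laplace_weight D c phi ->
  cmeasurable psi -> (forall x, D x -> absC (psi x) <= M * absC (phi x)) ->
  laplace_weight D c psi.
Proof.
move=> [mD mc mphi c0 ci] mpsi le; split=> // s s0.
apply: (le_integrable_real mD (h := fun x => M * (expR (- s * c x) * absC (phi x)))).
- apply: measurable_funTS; apply: measurable_funM; last exact: cmeasurable_absC.
  apply: measurableT_comp; first exact: measurable_expR.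
  by apply: measurable_funM.
- move=> x Dx; rewrite normrM !ger0_norm ?absC_ge0 ?expR_ge0//.
  by rewrite mulrCA ler_wpM2l ?expR_ge0// le.
- exact: (@integrableZl _ _ _ mu D mD M _ (ci _ s0)).
Qed.

(** Half of the exponential pays for the factor c: from x <= e^x one gets c e^(-s c) <= (2/s) e^(-s
    c / 2). *)
Lemma laplace_weight_mul D c phi : laplace_weight D c phi ->
  laplace_weight D c (fun x => (c x)%:C * phi x).
Proof.
move=> [mD mc mphi c0 ci].
have m : cmeasurable (fun x => (c x)%:C * phi x).
  by apply: cmeasurableM => //; exact: cmeasurable_real.
split=> // s s0; have s2 : 0 < s / 2 by rewrite divr_gt0.
apply: (le_integrable_real mD
  (h := fun x => (s / 2)^-1 * (expR (- (s / 2) * c x) * absC (phi x)))).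
- apply: measurable_funTS; apply: measurable_funM; last exact: cmeasurable_absC.
  apply: measurableT_comp; first exact: measurable_expR.
  by apply: measurable_funM.
- move=> x Dx; rewrite absCM absC_real (ger0_norm (c0 _ Dx)).
  rewrite ger0_norm ?mulr_ge0 ?absC_ge0 ?expR_ge0 ?c0//.
  rewrite !mulrA ler_wpM2r ?absC_ge0// mulrC.
  have -> : - s * c x = - (s / 2 * c x) + - (s / 2) * c x by field.
  rewrite expRD mulrA ler_wpM2r ?expR_ge0//.
  rewrite expRN ler_pdivrMr ?expR_gt0// mulrC ler_pdivlMr// mulrC.
  by rewrite (le_trans _ (expR_ge1Dx _))// lerDr.
- exact: (@integrableZl _ _ _ mu D mD _ _ (ci _ s2)).
Qed.

(** The integrand of the difference is the kernel at z times the Taylor remainder of the exponential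
    at -h c, bounded by 2 |h|^2 c^2 e^(|h| c). Since |h| < Re z / 2, a factor e^(-Re z c / 2)
    survives and c^2 phi is still integrable against it. The constant 4 is the 2 of the Taylor bound
    times the 2 of [absC_integralC_le]. *)
Lemma laplace_quadratic D c phi z : laplace_weight D c phi -> 0 < Re z ->
  exists2 M : R, 0 <= M & forall h : R[i], absC h < Re z / 2 ->
    absC (laplace D c phi (z + h) - laplace D c phi z -
          h * - laplace D c (fun x => (c x)%:C * phi x) z) <= M * absC h ^+ 2.
Proof.
move=> W z0; have W1 := laplace_weight_mul W; have W2 := laplace_weight_mul W1.
have [mD mc mphi c0 _] := W.
have [_ _ _ _ ci] := W2.
have z2 : 0 < Re z / 2 by rewrite divr_gt0.
set I2 := \int[mu]_(x in D) (expR (- (Re z / 2) * c x) *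
                             absC ((c x)%:C * ((c x)%:C * phi x))).
exists (4 * I2) => [|h hz].
  by rewrite mulr_ge0// Rintegral_ge0// => x _; rewrite mulr_ge0 ?expR_ge0 ?absC_ge0.
have zh0 : 0 < Re (z + h).
  rewrite Re_add; have := ler_Re_absC h; rewrite ler_norml => /andP[hz' _].
  lra.
set A := fun x => expC (- (z + h) * (c x)%:C) * phi x.
set B := fun x => expC (- z * (c x)%:C) * phi x.
set C := fun x => expC (- z * (c x)%:C) * ((c x)%:C * phi x).
have iA : integrableC D A by exact: laplace_integrable.
have iB : integrableC D B by exact: laplace_integrable.
have iC : integrableC D C by exact: laplace_integrable.
have iB' := integrableCZ mD (-1) iB.
have iC' := integrableCZ mD h iC.
have iBC := integrableCD mD iB' iC'.
have -> : laplace D c phi (z + h) - laplace D c phi z -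
    h * - laplace D c (fun x => (c x)%:C * phi x) z =
    integralC D (fun x => A x + (-1 * B x + h * C x)).
  rewrite (integralCD mD iA iBC) (integralCD mD iB' iC') !integralCZ//.
  by rewrite mulrN opprK mulN1r addrA.
have := ci _ z2 => /(@integrableZl _ _ _ mu D mD (2 * absC h ^+ 2)) ih.
apply: (le_trans (absC_integralC_le mD (integrableCD mD iA iBC) ih _)).
  move=> x Dx /=.
  have -> : A x + (-1 * B x + h * C x) = B x *
      (expC (- h * (c x)%:C) - 1 - (- h * (c x)%:C)).
    rewrite /A /B /C (_ : - (z + h) * _ = - z * (c x)%:C + - h * (c x)%:C).
      by rewrite expCD; ring.
    by ring.
  rewrite absCM absC_laplace_kernel.
  apply: (le_trans (ler_wpM2l _ (absC_expC_taylor _))).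
    by rewrite mulr_ge0 ?absC_ge0 ?expR_ge0.
  rewrite !absCM absCN absC_real (ger0_norm (c0 _ Dx)).
  have -> : expR (- Re z * c x) * absC (phi x) *
      (2 * ((absC h * c x) ^+ 2 * expR (absC h * c x))) =
      2 * absC h ^+ 2 * (expR (- Re z * c x + absC h * c x) *
      (c x * (c x * absC (phi x)))) by rewrite expRD; ring.
  rewrite ler_wpM2l ?mulr_ge0 ?sqr_ge0 ?absC_ge0//.
  rewrite ler_wpM2r ?mulr_ge0 ?absC_ge0 ?c0// ler_expR -mulrDl.
  rewrite ler_wpM2r ?c0//; lra.
rewrite RintegralZl//; last exact: ci.
rewrite -/I2; lra.
Qed.

Lemma is_derive_laplace D c phi z : laplace_weight D c phi -> 0 < Re z ->
  is_derive (z : R[i]^o) 1 (laplace D c phi : R[i]^o -> R[i]^o)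
    (- laplace D c (fun x => (c x)%:C * phi x) z : R[i]^o).
Proof.
move=> W z0; have [M M0 le] := laplace_quadratic W z0.
by apply: is_deriveC_quadratic le; rewrite ?divr_gt0.
Qed.

End Laplace.

(** * Fundamental theorem of calculus on the half-line *)

Section FTC_halfline.
Context {R : realType}.
Local Notation mu := (@lebesgue_measure R).
Implicit Types (f F : R -> R) (A B : R).

(** Compact intervals that avoid 0, where integrands such as y ^ (b-1) may be singular. The upper
    end n+2 rather than n+1 keeps the interval for n = 0 nondegenerate. *)
Definition exhaust (n : nat) : set R := `[n.+1%:R^-1, n.+2%:R]%classic.

Let exhaust_lt n : n.+1%:R^-1 < n.+2%:R :> R.
Proof. by rewrite (@le_lt_trans _ _ 1)// ?invf_le1// ?ler1n// ltr1n. Qed.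

Lemma measurable_exhaust n : measurable (exhaust n).
Proof. exact: measurable_itv. Qed.

Lemma exhaust_near (x : R) : 0 < x -> \forall n \near \oo, exhaust n x.
Proof.
move=> x0; near=> n; rewrite /exhaust /= in_itv /=; apply/andP; split.
  rewrite -(invrK x) lef_pV2 ?posrE ?invr_gt0//.
  rewrite (@le_trans _ _ n%:R) ?ler_nat//.
  by near: n; exact: nbhs_infty_ger.
rewrite (@le_trans _ _ n%:R) ?ler_nat//; last by rewrite ltnW.
by near: n; exact: nbhs_infty_ger.
Unshelve. all: by end_near. Qed.

Lemma exhaust_pos n x : exhaust n x -> 0 < x.
Proof.
by rewrite /exhaust /= in_itv /= => /andP[+ _]; apply: lt_le_trans; rewrite invr_gt0.
Qed.

Lemma exhaust_nondecreasing : nondecreasing_seq exhaust.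
Proof.
move=> m n mn; apply/subsetPset => x; rewrite /exhaust /= !in_itv /=.
move=> /andP[h1 h2]; apply/andP; split.
  by rewrite (le_trans _ h1)// lef_pV2 ?posrE// ler_nat.
by rewrite (le_trans h2)// ler_nat.
Qed.

Lemma bigcup_exhaust : \bigcup_n exhaust n = `]0, +oo[%classic.
Proof.
apply/seteqP; split => x /=.
  by move=> [n _ /exhaust_pos]; rewrite in_itv/= andbT.
rewrite in_itv /= andbT => /exhaust_near[n _ /(_ n (leqnn _)) nx].
by exists n.
Qed.

Lemma integral_exhaust f F n :
  (forall x : R, 0 < x -> is_derive x (1 : R) F (f x)) ->
  (forall x : R, 0 < x -> {for x, continuous f}) ->
  (\int[mu]_(x in exhaust n) (f x)%:E = (F n.+2%:R)%:E - (F n.+1%:R^-1)%:E)%E.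
Proof.
move=> dF cf; apply: (continuous_FTC2 (exhaust_lt n)).
- apply: continuous_in_subspaceT => x; rewrite inE /= in_itv /= => /andP[h _].
  by apply: cf; apply: lt_le_trans h; rewrite invr_gt0.
- have cF x : 0 < x -> {for x, continuous F}.
    by move=> /dF[dx _]; exact/differentiable_continuous/derivable1_diffP.
  split.
  + move=> x; rewrite in_itv /= => /andP[h _].
    by have [] := dF x (lt_trans _ h); rewrite ?invr_gt0.
  + by apply: cvg_at_right_filter; apply: cF; rewrite invr_gt0.
  + by apply: cvg_at_left_filter; apply: cF.
- move=> x; rewrite in_itv /= => /andP[h _]; rewrite derive1E.
  by have [] := dF x (lt_trans _ h); rewrite ?invr_gt0.
Qed.

(** For f >= 0 the integrals over the exhausting intervals are increments of F, hence at most 2 M;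
    monotone convergence passes the bound to the half-line. This produces integrable majorants from
    explicit bounded primitives. *)
Lemma integrable_FTC f F (M : R) :
  (forall x : R, 0 < x -> is_derive x (1 : R) F (f x)) ->
  (forall x : R, 0 < x -> {for x, continuous f}) ->
  (forall x : R, 0 < x -> 0 <= f x) -> (forall x : R, 0 < x -> `|F x| <= M) ->
  measurable_fun setT f ->
  mu.-integrable `]0, +oo[ (EFin \o f).
Proof.
move=> dF cf f0 FM mf; apply/integrableP; split.
  exact/measurable_EFinP/measurable_funTS.
rewrite (@le_lt_trans _ _ (M + M)%:E) ?ltry//.
have -> : (\int[mu]_(x in `]0%R, +oo[) `|(EFin \o f) x| =
    \int[mu]_(x in `]0%R, +oo[) (EFin \o f) x)%E.
  apply: eq_integral => x; rewrite inE /= in_itv /= andbT => x0.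
  by rewrite ger0_norm// f0.
rewrite -bigcup_exhaust.
have H := @ge0_nondecreasing_set_cvg_integral _ (measurableTypeR R) R exhaust
  (EFin \o f) mu
  exhaust_nondecreasing measurable_exhaust
  (fun i => (measurable_EFinP _ _).2 (measurable_funTS mf))
  (fun i x xi => f0 x (exhaust_pos xi)).
rewrite -(cvg_lim _ H)//; apply: lime_le; first exact: cvgP H.
apply: nearW => n /=; rewrite (integral_exhaust _ dF cf) lee_fin.
rewrite (le_trans (ler_norm _))// (le_trans (ler_normB _ _))//.
by apply: lerD; apply: FM; rewrite ?invr_gt0.
Qed.

(** Here f may change sign, so integrability is assumed and the truncations of f to the exhausting
    intervals converge with |f| as dominating function. *)
Lemma Rintegral_FTC f F A B :
  (forall x : R, 0 < x -> is_derive x (1 : R) F (f x)) ->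
  (forall x : R, 0 < x -> {for x, continuous f}) ->
  measurable_fun setT f ->
  mu.-integrable `]0, +oo[ (EFin \o f) ->
  F x @[x --> 0^'+] --> A -> F x @[x --> +oo%R] --> B ->
  \int[mu]_(x in `]0, +oo[) f x = B - A.
Proof.
move=> dF cf mf fi FA FB.
have mE n : measurable_fun (`]0, +oo[%classic : set R) ((EFin \o f) \_ (exhaust n)).
  apply: measurable_funTS.
  apply: (measurable_restrictT (EFin \o f) (measurable_exhaust n)).1.
  by apply/measurable_EFinP; exact: measurable_funTS.
have f_f : {ae mu, forall x, x \in `]0, +oo[ ->
    ((EFin \o f) \_ (exhaust n)) x @[n --> \oo] --> (EFin \o f) x}.
  apply: aeW => x /=; rewrite in_itv /= andbT => x0.
  apply: cvg_near_cst; near=> n; rewrite patchE mem_set//.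
  by near: n; exact: exhaust_near.
have f_g : {ae mu, forall x n, x \in `]0, +oo[ ->
    (`|((EFin \o f) \_ (exhaust n)) x| <= (abse \o (EFin \o f)) x)%E}.
  apply: aeW => x n _ /=; rewrite patchE; case: ifPn => // _.
  by rewrite abse0 lee_fin.
have [_ _ H'] := @dominated_convergence _ (measurableTypeR R) R mu
  `]0, +oo[%classic (measurable_itv _) (fun n => (EFin \o f) \_ (exhaust n))
  (EFin \o f) (abse \o (EFin \o f)) mE
  ((measurable_EFinP _ _).2 (measurable_funTS mf)) f_f (integrable_abse fi) f_g.
have H : (\int[mu]_(x in exhaust n) (f x)%:E)%E @[n --> \oo] -->
    (\int[mu]_(x in `]0%R, +oo[) (f x)%:E)%E.
  apply: cvg_trans H'; apply: near_eq_cvg; apply: nearW => n /=.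
  rewrite -integral_mkcondr; congr (integral _ _ _).
  by apply/setIidPr => x /exhaust_pos; rewrite /= in_itv /= andbT.
have E : (F n.+2%:R - F n.+1%:R^-1)%:E @[n --> \oo] --> (B - A)%:E.
  apply: cvg_EFin; first exact: nearW.
  apply: cvgB.
  - move/cvg_pinftyP : FB; apply.
    apply/cvgryPge => M; near=> n.
    rewrite (@le_trans _ _ n%:R) ?ler_nat//; last exact/leqW/leqW.
    by near: n; exact: nbhs_infty_ger.
  - move/cvg_at_rightP : FA; apply; split=> [n|]; first by rewrite invr_gt0.
    exact: cvg_harmonic.
rewrite /Rintegral.
have {}H : (F n.+2%:R - F n.+1%:R^-1)%:E @[n --> \oo] -->
    (\int[mu]_(x in `]0%R, +oo[) (f x)%:E)%E.
  by apply: cvg_trans H; apply: near_eq_cvg; apply: nearW => n;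
    rewrite (integral_exhaust _ dF cf).
by rewrite (cvg_unique _ H E).
Unshelve. all: by end_near. Qed.

End FTC_halfline.

(** * Calculus of complex-valued functions of a real variable *)

Section ComplexDerive.
Context {R : realType}.
Local Notation Re := complex.Re.
Local Notation Im := complex.Im.
Implicit Types (F f g : R -> R[i]) (x : R) (l k : R[i]).

(** Encoded by components so that the real mean value theorem and the real fundamental theorem apply
    to each part. *)
Definition cderive F x l : Prop :=
  is_derive x (1 : R) (fun y : R => Re (F y)) (Re l) /\
  is_derive x (1 : R) (fun y : R => Im (F y)) (Im l).

Lemma cderive_eq F x k l : cderive F x k -> k = l -> cderive F x l.
Proof. by move=> ? <-. Qed.

Lemma cderive_cst k x : cderive (fun=> k) x 0.
Proof. by split; exact: is_derive_cst. Qed.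

Lemma cderive_real (h : R -> R) (dh : R) x : is_derive x (1 : R) h dh ->
  cderive (fun y => (h y)%:C) x dh%:C.
Proof. by move=> ?; split => //=; exact: is_derive_cst. Qed.

Lemma cderiveD f g x k l : cderive f x k -> cderive g x l ->
  cderive (fun y => f y + g y) x (k + l).
Proof.
move=> [rf jf] [rg jg]; split.
  by under eq_fun do rewrite Re_add; rewrite Re_add; exact: is_deriveD.
by under eq_fun do rewrite Im_add; rewrite Im_add; exact: is_deriveD.
Qed.

Lemma cderiveM f g x k l : cderive f x k -> cderive g x l ->
  cderive (fun y => f y * g y) x (k * g x + f x * l).
Proof.
move=> [rf jf] [rg jg]; split.
  under eq_fun do rewrite Re_mul.
  apply: is_derive_eq; rewrite !ReImE /GRing.scale /=; ring.
under eq_fun do rewrite Im_mul.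
apply: is_derive_eq; rewrite !ReImE /GRing.scale /=; ring.
Qed.

Lemma cderiveZ f x k l : cderive f x l -> cderive (fun y => k * f y) x (k * l).
Proof.
move=> df; apply: cderive_eq (cderiveM (cderive_cst k x) df) _.
by rewrite mul0r add0r.
Qed.

Lemma cderive_expC f x k : cderive f x k ->
  cderive (fun y => expC (f y)) x (k * expC (f x)).
Proof.
move=> [rf jf]; split.
  under eq_fun do rewrite Re_expC.
  apply: is_derive_eq; rewrite !ReImE /GRing.scale /=; ring.
under eq_fun do rewrite Im_expC.
apply: is_derive_eq; rewrite !ReImE /GRing.scale /=; ring.
Qed.

Lemma cderive_continuous F x l : cderive F x l ->
  {for x, continuous (fun y => Re (F y))} /\ {for x, continuous (fun y => Im (F y))}.
Proof.
by move=> [[dr _] [dj _]]; split; exact/differentiable_continuous/derivable1_diffP.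
Qed.

Lemma cderive_quadratic F x l (M e : R) : 0 <= M -> 0 < e ->
  (forall h : R, `|h| < e ->
    absC (F (x + h) - F x - h%:C * l) <= M * `|h| ^+ 2) ->
  cderive F x l.
Proof.
move=> M0 e0 FM; split; apply: (is_derive_quadratic M0 e0) => h /FM.
  by apply: le_trans; rewrite (le_trans _ (ler_Re_absC _))// !ReImE mul0r subr0.
by apply: le_trans; rewrite (le_trans _ (ler_Im_absC _))// !ReImE mul0r addr0.
Qed.

(** Chain rule for a complex-differentiable G along a curve c in the plane, with both
    differentiabilities given as quadratic remainders. The error splits into the remainder of G at
    the increment h of c and the remainder of c multiplied by k. *)
Lemma cderive_comp_quadratic (G : R[i] -> R[i]) (c : R -> R[i]) x k l (M N e r : R) :
  0 <= M -> 0 <= N -> 0 < e -> 0 < r ->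
  (forall h, absC h < e -> absC (G (c x + h) - G (c x) - h * k) <= M * absC h ^+ 2) ->
  (forall q : R, `|q| < r -> absC (c (x + q) - c x - q%:C * l) <= N * `|q| ^+ 2) ->
  cderive (fun y => G (c y)) x (l * k).
Proof.
move=> M0 N0 e0 r0 GM cN; pose B := absC l + N.
have B0 : 0 <= B by rewrite addr_ge0// absC_ge0.
have B1 : 0 < B + 1 by rewrite ltr_wpDl.
(* In the radius, 1 turns |q|^2 into |q|, so that |h| <= B |q|; e / (B + 1) then keeps h in the disc
   where the bound on G holds, the + 1 guarding against B = 0. *)
apply: (@cderive_quadratic _ _ _ (M * B ^+ 2 + N * absC k)
    (Num.min r (Num.min 1 (e / (B + 1))))).
- by rewrite addr_ge0// mulr_ge0 ?sqr_ge0 ?absC_ge0.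
- by rewrite !lt_min r0 ltr01 divr_gt0.
move=> q; rewrite !lt_min => /and3P[qr q1 qe].
set h := c (x + q) - c x.
have dh : absC (h - q%:C * l) <= N * `|q| ^+ 2 by exact: cN.
have hB : absC h <= `|q| * B.
  rewrite -[h](subrK (q%:C * l)) (le_trans (absCD _ _))// absCM absC_real mulrDr.
  rewrite addrC lerD2l (le_trans dh)// mulrC ler_wpM2r// expr2.
  by rewrite ler_piMl// ltW.
have he : absC h < e.
  rewrite (le_lt_trans hB)// (le_lt_trans _ (_ : `|q| * (B + 1) < _))//.
    by rewrite ler_wpM2l// lerDl.
  by rewrite -ltr_pdivlMr.
have -> : c (x + q) = c x + h by rewrite /h [c x + _]addrC subrK.
have -> : G (c x + h) - G (c x) - q%:C * (l * k) =
    (G (c x + h) - G (c x) - h * k) + (h - q%:C * l) * k by ring.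
rewrite (le_trans (absCD _ _))// [leRHS]mulrDl lerD//.
  rewrite (le_trans (GM _ he))// -mulrA ler_wpM2l// -exprMn lerXn2r//.
  - by rewrite nnegrE absC_ge0.
  - by rewrite nnegrE mulr_ge0.
  - by rewrite mulrC.
by rewrite absCM mulrAC ler_wpM2r// absC_ge0.
Qed.

Lemma cderive_0_cst F (a b : R) : a <= b ->
  (forall x, a <= x <= b -> cderive F x 0) -> F b = F a.
Proof.
move=> ab dF.
have H (h : R -> R) : (forall x, a <= x <= b -> is_derive x (1 : R) h 0) -> h b = h a.
  move=> dh; have [||c _] := @MVT_segment R h (fun=> 0) a b ab.
  - by move=> x; rewrite in_itv /= => /andP[/ltW ax /ltW xb]; apply: dh; rewrite ax.
  - by apply: derivable_within_continuous => x; rewrite in_itv /= => /dh[].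
  - by rewrite mul0r => /eqP; rewrite subr_eq0 => /eqP.
by apply: complex_eqP; [apply: (H (fun x => Re (F x)))|apply: (H (fun x => Im (F x)))]
  => x /dF[].
Qed.

(** The second hypothesis is the source of the continuity of f required by the real theorem. Real
    and imaginary parts are handled by one argument, for a real-valued P dominated by the
    modulus. *)
Lemma integralC_FTC F f :
  (forall x, 0 < x -> cderive F x (f x)) ->
  (forall x, 0 < x -> exists l, cderive f x l) ->
  cmeasurable f -> integrableC `]0, +oo[%classic f ->
  absC (F x) @[x --> 0^'+] --> (0 : R) ->
  absC (F x) @[x --> +oo%R] --> (0 : R) ->
  integralC `]0, +oo[%classic f = 0.
Proof.
move=> dF df [mr mj] [ir ij] F0 Fy.
have sq (P : R -> R) (G : set_system R) (FF : Filter G) :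
    (forall x, `|P x| <= absC (F x)) -> absC (F x) @[x --> G] --> (0 : R) ->
    P x @[x --> G] --> (0 : R).
  move=> le c; apply/norm_cvg0P; apply: squeeze_cvgr (cvg_cst 0) c.
  by near=> x; rewrite normr_ge0 le.
have E (P : R[i] -> R) : (forall w, `|P w| <= absC w) ->
    (forall G x l, cderive G x l -> is_derive x (1 : R) (fun y => P (G y)) (P l)) ->
    measurable_fun setT (fun x => P (f x)) ->
    (@lebesgue_measure R).-integrable `]0, +oo[ (fun x => (P (f x))%:E) ->
    \int[@lebesgue_measure R]_(x in `]0, +oo[) P (f x) = 0.
  move=> le dP mP iP; rewrite -[RHS](subrr 0).
  apply: (@Rintegral_FTC _ _ (fun x => P (F x))) => //.
  - by move=> x /dF/dP.
  - move=> x /df[l /dP[dl _]].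
    exact/differentiable_continuous/derivable1_diffP.
  - by apply: sq F0 => x; exact: le.
  - by apply: sq Fy => x; exact: le.
apply: complex_eqP => /=.
  by apply: (E (@complex.Re R)) => // [w|G x l []//]; exact: ler_Re_absC.
by apply: (E (@complex.Im R)) => // [w|G x l []//]; exact: ler_Im_absC.
Unshelve. all: by end_near. Qed.

End ComplexDerive.

(** * The Gamma integral at a complex point *)

Section GammaKernel.
Context {R : realType}.
Local Notation mu := (@lebesgue_measure R).
Local Notation Re := complex.Re.
Local Notation Im := complex.Im.
Implicit Types (b s x y : R).

(** This is ln x < x at x = s y / b, multiplied by b and exponentiated, with K = (s / b) ^ (-b). *)
Lemma powR_le_expR b s : 0 < b -> 0 < s ->
  exists2 K : R, 0 < K & forall y, 0 < y -> y `^ b <= K * expR (s * y).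
Proof.
move=> b0 s0; have e0 : 0 < s / b by rewrite divr_gt0.
exists (expR (- b * ln (s / b))); first exact: expR_gt0.
move=> y y0; rewrite -expRD /powR gt_eqF// ler_expR.
have : ln (s / b * y) < s / b * y by rewrite ln_sublinear// mulr_gt0.
rewrite lnM ?posrE// => h.
have {h} : b * (ln (s / b) + ln y) <= b * (s / b * y) by rewrite ler_wpM2l// ltW.
have -> : b * (s / b * y) = s * y by field; rewrite gt_eqF.
lra.
Qed.

Definition gamma_kernel b y : R[i] := (y `^ (b - 1))%:C.

Lemma measurable_powR_sub1 b : measurable_fun setT (fun y : R => y `^ (b - 1)).
Proof. exact: measurable_powR. Qed.

Let continuous_powR b x : 0 < x -> {for x, continuous (fun y : R => y `^ b)}.
Proof.
move=> x0; apply/differentiable_continuous/derivable1_diffP.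
by have [] := is_derive1_powR b x0.
Qed.

(** The majorant is a multiple of b y^(b-1) / (1 + y^b)^2, the derivative of the bounded function -1
    / (1 + y^b). It has the singularity of the kernel at 0 and is integrable at infinity, for every
    b > 0 without case distinction. It dominates because (1 + y^b) e^(-s y / 2) <= 1 + K,
    squared. *)
Lemma laplace_weight_gamma b : 0 < b ->
  laplace_weight `]0, +oo[%classic id (gamma_kernel b).
Proof.
move=> b0; have mp := measurable_powR_sub1 b.
split.
- exact: measurable_itv.
- exact: measurable_id.
- exact: cmeasurable_real.
- by move=> x /=; rewrite in_itv/= andbT => /ltW.
move=> s s0; have s2 : 0 < s / 2 by rewrite divr_gt0.
have [K K0 Kle] := powR_le_expR b0 s2.
pose f y := b * y `^ (b - 1) * (1 + y `^ b) ^- 2.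
have pos (x : R) : 0 < 1 + x `^ b by rewrite ltr_pwDl// powR_ge0.
have mf : measurable_fun setT f.
  apply: measurable_funM.
    exact: measurable_funM.
  have -> : (fun y : R => (1 + y `^ b) ^- 2) = (fun y => (1 + y `^ b) `^ (- 2%:R)).
    by apply/funext => y; rewrite powR_invn// ltW.
  apply: (@measurableT_comp _ _ _ _ _ _ (fun y : R => y `^ (- 2%:R))).
    exact: measurable_powR.
  by apply: measurable_funD => //; exact: measurable_powR.
have fi : mu.-integrable `]0, +oo[ (EFin \o f).
  apply: (@integrable_FTC _ f (fun y => - (1 + y `^ b)^-1) 1) => //.
  - move=> x x0; have D := is_derive1_powR b x0.
    have D1 : is_derive x (1:R) (fun y : R => 1 + y `^ b) (b * x `^ (b - 1)).
      by rewrite -[X in is_derive _ _ _ X]add0r; exact: is_deriveD.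
    have D2 := @is_deriveV _ (fun y : R => 1 + y `^ b) x _ _
      (lt0r_neq0 (pos x)) D1.
    by apply: is_derive_eq; rewrite /f /GRing.scale /= mulNr opprK mulrC.
  - move=> x x0; rewrite /f; apply: cvgM.
      by apply: cvgM; [exact: cvg_cst|exact: continuous_powR].
    apply: cvgV; first by rewrite expf_neq0// gt_eqF.
    by apply: cvgM; apply: cvgD; (exact: cvg_cst || exact: continuous_powR).
  - move=> x x0; rewrite /f mulr_ge0//.
      by rewrite mulr_ge0 ?powR_ge0 ?(ltW b0).
    by rewrite invr_ge0 exprn_ge0 ?(ltW (pos x)).
  - move=> x x0; rewrite normrN ger0_norm ?invr_ge0 ?(ltW (pos x))//.
    by rewrite invf_le1// lerDl powR_ge0.
have ci := @integrableZl _ _ _ mu `]0, +oo[%classic (measurable_itv _)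
   ((1 + K) ^+ 2 / b) _ fi.
apply: (le_integrable_real _ _ _ ci) => /=.
- exact: measurable_itv.
- apply: measurable_funTS; apply: measurable_funM.
    apply: measurableT_comp; first exact: measurable_expR.
    by apply: measurable_funM.
  by apply: cmeasurable_absC; exact: cmeasurable_real.
move=> x; rewrite /= in_itv /= andbT => x0.
rewrite ger0_norm ?mulr_ge0 ?expR_ge0 ?absC_ge0//.
rewrite /gamma_kernel absC_real ger0_norm ?powR_ge0// /f.
have -> : (1 + K) ^+ 2 / b * (b * x `^ (b - 1) * (1 + x `^ b) ^- 2) =
   (1 + K) ^+ 2 * (1 + x `^ b) ^- 2 * x `^ (b - 1).
  by field; rewrite !gt_eqF.
rewrite ler_wpM2r ?powR_ge0// ler_pdivlMr ?exprn_gt0//.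
have -> : - s * x = 2%:R * - (s / 2 * x) by field.
rewrite expRM_natl -exprMn.
rewrite lerXn2r ?nnegrE ?mulr_ge0 ?expR_ge0 ?(ltW (pos x)) ?addr_ge0 ?(ltW K0)//.
rewrite expRN ler_pdivrMl ?expR_gt0// mulrC mulrDl mul1r.
by rewrite lerD ?Kle// -[leLHS]expR0 ler_expR mulr_ge0// ltW.
Qed.

End GammaKernel.

Section GammaLaplace.
Context {R : realType}.
Local Notation mu := (@lebesgue_measure R).
Local Notation Re := complex.Re.
Local Notation Im := complex.Im.
Implicit Types (b x y : R) (s z : R[i]).

Lemma cvg_expR_decay (c : R) : 0 < c -> expR (- c * x) @[x --> +oo%R] --> (0 : R).
Proof.
move=> c0; under eq_fun do rewrite mulNr.
apply: (cvg_comp (fun x => c * x) (fun y => expR (- y)) _ (@cvgr_expR R)).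
exact: gt0_cvgMry.
Qed.

(** The functional equation Gamma(b + 1) = b Gamma(b) at a complex abscissa, from integrating the
    derivative of y^b e^(-s y), which vanishes at both ends. Since differentiating in s brings out
    -y, it reads s G'(s) = - b G(s) for G the Laplace integral of y^(b-1). *)
Lemma gamma_ibp b s : 0 < b -> 0 < Re s ->
  s * laplace `]0, +oo[%classic id (fun y => y%:C * gamma_kernel b y) s =
  b%:C * laplace `]0, +oo[%classic id (gamma_kernel b) s.
Proof.
move=> b0 s0; have W := laplace_weight_gamma b0.
have W1 := laplace_weight_mul W.
have i0 := laplace_integrable W s0; have i1 := laplace_integrable W1 s0.
have mD := measurable_itv `]0, +oo[ : measurable (`]0, +oo[%classic : set R).
pose f y := b%:C * (expC (- s * y%:C) * gamma_kernel b y) +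
           - s * (expC (- s * y%:C) * (y%:C * gamma_kernel b y)).
pose F y := expC (- s * y%:C) * (y `^ b)%:C.
have dE (x : R) : cderive (fun y => expC (- s * y%:C)) x (- s * expC (- s * x%:C)).
  apply: cderive_eq (cderive_expC (cderiveZ (- s) (cderive_real (is_derive_id x 1)))) _.
  by rewrite mulr1.
have dk (x : R) : 0 < x -> cderive (gamma_kernel b) x
    ((b - 1) * x `^ (b - 1 - 1))%:C.
  by move=> x0; apply: cderive_real; exact: is_derive1_powR.
have : integralC `]0, +oo[%classic f = 0.
  apply: (@integralC_FTC _ F).
  - move=> x x0; have dp := cderive_real (is_derive1_powR b x0).
    apply: cderive_eq (cderiveM (dE x) dp) _.
    rewrite /f /gamma_kernel -(mulr_powRB1 (ltW x0) b0) !rmorphM /=; ring.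
  - move=> x x0; eexists; apply: cderiveD; apply: cderiveZ; apply: cderiveM.
    + exact: dE.
    + exact: dk.
    + exact: dE.
    + apply: cderiveM; last exact: dk.
      exact: cderive_real (is_derive_id x 1).
  - have [_ mid mk _ _] := W; have [_ _ mk1 _ _] := W1.
    apply: cmeasurableD; apply: cmeasurableM; try exact: cmeasurable_cst.
      exact: cmeasurable_laplace_kernel mid mk.
    exact: cmeasurable_laplace_kernel mid mk1.
  - by apply: integrableCD => //; exact: integrableCZ.
  - have := powR_cvg0 b0; apply: squeeze_cvgr (cvg_cst 0); near=> x.
    have x0 : 0 < x by near: x; exact: nbhs_right_gt.
    rewrite absC_ge0 /F absCM absC_expC absC_real ger0_norm ?powR_ge0//.
    rewrite ler_piMl ?powR_ge0// -[leRHS]expR0 ler_expR !ReImE mulr0 subr0.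
    by rewrite mulNr oppr_le0 mulr_ge0// ltW.
  - have s2 : 0 < Re s / 2 by rewrite divr_gt0.
    have [K K0 Kle] := powR_le_expR b0 s2.
    have : K * expR (- (Re s / 2) * x) @[x --> +oo%R] --> (0 : R).
      rewrite -[X in _ --> X](mulr0 K).
      by apply: cvgM; [exact: cvg_cst|exact: cvg_expR_decay].
    apply: squeeze_cvgr (cvg_cst 0); near=> x.
    have x0 : 0 < x by near: x; exact: nbhs_pinfty_gt.
    rewrite absC_ge0 /F absCM absC_expC absC_real ger0_norm ?powR_ge0//.
    rewrite (le_trans (ler_wpM2l (expR_ge0 _) (Kle _ x0)))//.
    rewrite mulrCA ler_wpM2l ?(ltW K0)// -expRD ler_expR !ReImE mulr0 subr0.
    by rewrite le_eqVlt; apply/orP; left; apply/eqP; field.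
rewrite (integralCD mD (integrableCZ mD _ i0) (integrableCZ mD _ i1)) !integralCZ//.
by rewrite mulNr => /eqP; rewrite subr_eq0 => /eqP <-.
Unshelve. all: by end_near. Qed.

End GammaLaplace.

(** * Principal logarithm on the right half-plane and the Gamma integral along a curve *)

Section GammaPath.
Context {R : realType}.
Local Notation mu := (@lebesgue_measure R).
Local Notation Re := complex.Re.
Local Notation Im := complex.Im.
Implicit Types (b x y : R) (s z : R[i]).

Let ratio_itv z : 0 < Re z -> 0 < Re z / absC z <= 1.
Proof.
move=> z0; have a0 := absC_gt0 z0.
rewrite divr_gt0//= ler_pdivrMr// mul1r.
by rewrite (le_trans (ler_norm _))// ler_Re_absC.
Qed.

(** If acos x were at least pi/2, then sin (acos x - pi/2) = -x would be nonnegative, against x > 0.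
    The bound keeps the curve p |-> e^(p log z), 0 <= p <= 1, inside the half-plane, its argument
    being p arg z. *)
Lemma argC_lt_pihalf z : 0 < Re z -> `|argC z| < pi / 2.
Proof.
move=> z0; have /andP[t0 t1] := ratio_itv z0.
have t : -1 <= Re z / absC z <= 1 by rewrite t1 (le_trans _ (ltW t0))// lerN10.
suff lt : acos (Re z / absC z) < pi / 2.
  by rewrite /argC; case: ifP => _; rewrite ?normrN ger0_norm ?acos_ge0.
rewrite ltNge; apply/negP => le.
have := acosK; move=> /(_ R (Re z / absC z)); rewrite in_itv /= => /(_ t) e.
have := acos_lepi t => le'.
have : 0 <= sin (acos (Re z / absC z) - pi / 2).
  rewrite sin_ge0_pi// subr_ge0 le /= lerBlDr (le_trans le')// lerDl.
  by rewrite divr_ge0// pi_ge0.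
by rewrite sinB cos_pihalf sin_pihalf mulr0 mulr1 sub0r e oppr_ge0 leNgt t0.
Qed.

Lemma expC_lnC z : 0 < Re z -> expC (lnC z) = z.
Proof.
move=> z0; have a0 := absC_gt0 z0; have /andP[t0 t1] := ratio_itv z0.
have t : -1 <= Re z / absC z <= 1 by rewrite t1 (le_trans _ (ltW t0))// lerN10.
have an0 : absC z != 0 by rewrite gt_eqF.
have cE : cos (acos (Re z / absC z)) = Re z / absC z.
  by apply: acosK; rewrite in_itv.
have sE : sin (acos (Re z / absC z)) = `|Im z| / absC z.
  rewrite sin_acos//.
  have -> : 1 - (Re z / absC z) ^+ 2 = (Im z / absC z) ^+ 2.
    rewrite !expr_div_n absC_sqr.
    by field; rewrite -absC_sqr expf_neq0.
  by rewrite sqrtr_sqr normrM normfV (ger0_norm (absC_ge0 z)).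
apply: complex_eqP; rewrite ?Re_expC ?Im_expC /= lnK ?posrE//.
  rewrite /argC; case: ifP => _; rewrite ?cosN cE; by field.
rewrite /argC; case: ifP => [i0|/negbT].
  by rewrite sE ger0_norm//; field.
by rewrite -ltNge => i0; rewrite sinN sE ltr0_norm//; field.
Qed.

Lemma lnCZ (c : R) z : 0 < c -> 0 < Re z -> lnC (c%:C * z) = (ln c)%:C + lnC z.
Proof.
move=> c0 z0; have aE : absC (c%:C * z) = c * absC z.
  by rewrite absCM absC_real gtr0_norm.
have a0 := absC_gt0 z0.
have rE : Re (c%:C * z) = c * Re z by rewrite !ReImE mul0r subr0.
have jE : Im (c%:C * z) = c * Im z by rewrite !ReImE mul0r addr0.
have reE w : Re (@lnC R w) = ln (absC w) by [].
have imE w : Im (@lnC R w) = argC w by [].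
apply: complex_eqP; first by rewrite Re_add !reE aE lnM ?posrE.
rewrite Im_add !imE add0r.
rewrite /argC aE rE jE (pmulr_rge0 _ c0).
by rewrite -mulf_div divff ?mul1r// gt_eqF.
Qed.

(** A positive factor leaves the argument unchanged, so the principal branch is multiplicative here;
    this is how c(t) ^ b comes out of (z c(t)) ^ b. *)
Lemma powCZ (c : R) z b : 0 < c -> 0 < Re z ->
  powC (c%:C * z) b = (c `^ b)%:C * powC z b.
Proof.
move=> c0 z0; rewrite /powC lnCZ// mulrDr expCD -rmorphM expC_real.
by rewrite /powR gt_eqF.
Qed.

Lemma absC_powC z b : 0 < Re z -> absC (powC z b) = absC z `^ b.
Proof.
move=> z0; have a0 := absC_gt0 z0.
by rewrite /powC absC_expC !ReImE mul0r subr0 /powR gt_eqF.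
Qed.

(* Follows [G = laplace id (gamma_kernel b)] along the path [expC (p * lnC z)],
   which joins 1 to z inside the half-plane: [expC (b p lnC z) * G] has derivative
   zero since [s G'(s) = - b G(s)]. *)
Lemma powC_gamma_laplace b z : 0 < b -> 0 < Re z ->
  powC z b * laplace `]0, +oo[%classic id (gamma_kernel b) z = (Gamma b)%:C.
Proof.
move=> b0 z0; have W := laplace_weight_gamma b0.
set G := laplace _ _ _.
have G1 : G 1 = (Gamma b)%:C.
  rewrite /G /laplace /Gamma -integralC_real; apply: eq_integralC => y _.
  by rewrite mulN1r -rmorphN expC_real -rmorphM mulrC.
pose w := lnC z.
pose g p := expC (p%:C * w).
have dline k p : cderive (fun q : R => expC (k * (q%:C * w))) p
    (k * w * expC (k * (p%:C * w))).
  apply: cderive_eq (cderive_expC (cderiveZ k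
    (cderiveM (cderive_real (is_derive_id p 1)) (cderive_cst w p)))) _.
  by rewrite mulr0 addr0 mul1r.
have g_gt0 (p : R) : 0 <= p <= 1 -> 0 < Re (g p).
  move=> /andP[p0 p1]; rewrite Re_expC mulr_gt0 ?expR_gt0// cos_gt0_pihalf//.
  rewrite !ReImE mul0r addr0 -ltr_norml normrM (ger0_norm p0).
  by rewrite (le_lt_trans _ (argC_lt_pihalf z0))// ler_piMl.
have dG (p : R) : 0 <= p <= 1 -> cderive (fun q => G (g q)) p
    (w * g p * - laplace `]0, +oo[%classic id (fun y => y%:C * gamma_kernel b y) (g p)).
  move=> p01; have [M M0 GM] := laplace_quadratic W (g_gt0 _ p01).
  (* The remainder of the curve is g p times the Taylor remainder of the exponential at q w; the
     radius 1 bounds e^(|q w|) by e^(|w|), which gives a constant free of q. *)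
  apply: (@cderive_comp_quadratic _ G g p _ _ M
    (absC (g p) * (2 * (absC w ^+ 2 * expR (absC w)))) _ 1 M0 _ _ _ GM) => //.
  - by rewrite !mulr_ge0 ?absC_ge0 ?expR_ge0 ?sqr_ge0.
  - by rewrite divr_gt0// g_gt0.
  move=> q q1.
  have -> : g (p + q) - g p - q%:C * (w * g p) =
      g p * (expC (q%:C * w) - 1 - q%:C * w).
    by rewrite /g rmorphD mulrDl expCD; ring.
  rewrite absCM -[leRHS]mulrA ler_wpM2l ?absC_ge0//.
  rewrite (le_trans (absC_expC_taylor _))// -[leRHS]mulrA ler_wpM2l//.
  rewrite absCM absC_real exprMn -[leLHS]mulrA mulrC ler_wpM2r ?sqr_ge0//.
  by rewrite ler_wpM2l ?sqr_ge0// ler_expR ler_piMl ?absC_ge0// (ltW q1).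
pose Phi p := expC (b%:C * (p%:C * w)) * G (g p).
have e : Phi 1 = Phi 0.
  apply: (@cderive_0_cst _ Phi 0 1 ler01) => p p01.
  apply: cderive_eq (cderiveM (dline b%:C p) (dG _ p01)) _.
  have ibp := gamma_ibp b0 (g_gt0 _ p01).
  rewrite -/G in ibp.
  transitivity (expC (b%:C * (p%:C * w)) * w * (b%:C * G (g p) - g p *
    laplace `]0, +oo[%classic id (fun y => y%:C * gamma_kernel b y) (g p))).
    ring.
  by rewrite ibp subrr mulr0.
move: e; rewrite /Phi /g !mul1r !mul0r mulr0 expC0 mul1r G1 => <-.
by rewrite /w expC_lnC.
Qed.

End GammaPath.

(** * Fractional integral of a Laplace integral *)

Section FubiniSet.
Context d1 d2 (T1 : measurableType d1) (T2 : measurableType d2) (R : realType).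
Variable m1 : {sigma_finite_measure set T1 -> \bar R}.
Variable m2 : {sigma_finite_measure set T2 -> \bar R}.
Variables (A : set T1) (B : set T2) (mA : measurable A) (mB : measurable B).
Variables (f : T1 * T2 -> R) (k : T2 -> R).
Hypothesis mf : measurable_fun setT f.
Hypothesis fA : forall x, A x -> m2.-integrable B (fun y => (f (x, y))%:E).
Hypothesis fB : forall y, B y -> m1.-integrable A (fun x => (f (x, y))%:E).
Hypothesis ik : m2.-integrable B (EFin \o k).
Hypothesis fk : forall y, B y -> \int[m1]_(x in A) `|f (x, y)| <= k y.

(** Extension by zero outside the rectangle, so that Fubini on the whole product applies and each
    slice is again a function extended by zero. *)
Let h : T1 * T2 -> \bar R := (EFin \o f) \_ (A `*` B).

Let hA x : A x -> (fun y => h (x, y)) = (fun y => (f (x, y))%:E) \_ B.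
Proof.
move=> Ax; apply/funext => y; rewrite /h !patchE.
have -> : ((x, y) \in A `*` B) = (y \in B); last by [].
by apply/idP/idP; rewrite !inE; [case|split].
Qed.

Let hAN x : ~ A x -> (fun y => h (x, y)) = cst 0%E.
Proof.
move=> Ax; apply/funext => y; rewrite /h !patchE memNset//.
by move=> [].
Qed.

Let hB y : B y -> (fun x => h (x, y)) = (fun x => (f (x, y))%:E) \_ A.
Proof.
move=> By; apply/funext => x; rewrite /h !patchE.
have -> : ((x, y) \in A `*` B) = (x \in A); last by [].
by apply/idP/idP; rewrite !inE; [case|split].
Qed.

Let hBN y : ~ B y -> (fun x => h (x, y)) = cst 0%E.
Proof.
move=> By; apply/funext => x; rewrite /h !patchE memNset//.
by move=> [].
Qed.

Let mh : measurable_fun setT h.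
Proof.
apply: (measurable_restrictT (EFin \o f) (measurableX mA mB)).1.
by apply/measurable_EFinP; exact: measurable_funTS.
Qed.

(** Tonelli in the order that k controls: the inner integral over A of |f| is at most k, which is
    integrable over B. *)
Let ih : (m1 \x m2)%E.-integrable setT h.
Proof.
apply/(integrable21ltyP m1 m2 mh).
apply: (@le_lt_trans _ _ (\int[m2]_(y in B) `|(EFin \o k) y|)%E); last first.
  by move/integrableP : ik => [].
rewrite [leRHS]integral_mkcond; apply: ge0_le_integral => //.
- by move=> y _; exact: integral_ge0.
- apply: (measurable_fun_fubini_tonelli_G (abse \o h)) => //=.
  exact: measurableT_comp.
- apply: (measurable_restrictT _ mB).1; apply: measurableT_comp => //.
  exact: measurable_int ik.
- move=> y _; rewrite patchE; case: ifPn => [|/negP]; rewrite inE => By.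
  + have -> : (\int[m1]_x `|h (x, y)| = \int[m1]_(x in A) (`|f (x, y)|)%:E)%E.
      rewrite [RHS]integral_mkcond; apply: eq_integral => x _.
      have -> : h (x, y) = ((fun x => (f (x, y))%:E) \_ A) x by rewrite -hB.
      by rewrite !patchE; case: ifP => // _; rewrite abse0.
    rewrite -[leLHS]fineK; last exact/integrable_fin_num/(integrable_norm (fB By)).
    by rewrite lee_fin (le_trans (fk By))// ler_norm.
  + rewrite integral0_eq// => x _.
    have -> : h (x, y) = 0%E by rewrite -[LHS]/((fun x => h (x, y)) x) hBN.
    by rewrite abse0.
Qed.

(** Integrability of every slice over A, not merely almost every one, makes the inner integrals
    finite, so the real-valued and extended inner integrals agree pointwise. *)
Let FE x : (\int[m2]_y h (x, y))%E = ((fun x => \int[m2]_(y in B) f (x, y)) \_ A x)%:E.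
Proof.
rewrite patchE; case: ifPn => [|/negP]; rewrite inE => Ax.
  rewrite hA// -integral_mkcond /Rintegral fineK//.
  exact/integrable_fin_num/fA.
by rewrite hAN// integral_cst// mul0e.
Qed.

Let GE y : (\int[m1]_x h (x, y))%E = ((fun y => \int[m1]_(x in A) f (x, y)) \_ B y)%:E.
Proof.
rewrite patchE; case: ifPn => [|/negP]; rewrite inE => By.
  rewrite hB// -integral_mkcond /Rintegral fineK//.
  exact/integrable_fin_num/fB.
by rewrite hBN// integral_cst// mul0e.
Qed.

Lemma integrable_Rintegral_Fubini :
  m1.-integrable A (fun x => (\int[m2]_(y in B) f (x, y))%:E).
Proof.
apply/integrable_mkcond => //.
have := integrable_fubini_F ih; apply: eq_integrable => // x _.
by rewrite /fubini_F FE !patchE; case: ifP.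
Qed.

Lemma Rintegral_Fubini :
  \int[m1]_(x in A) \int[m2]_(y in B) f (x, y) =
  \int[m2]_(y in B) \int[m1]_(x in A) f (x, y).
Proof.
rewrite Rintegral_mkcond [RHS]Rintegral_mkcond /Rintegral.
under eq_integral do rewrite -FE.
under [in RHS]eq_integral do rewrite -GE.
by congr fine; exact: Fubini ih.
Qed.

End FubiniSet.

(** * The translation x = y + 1 and the fractional integral of the exponential *)

Section Shift.
Context {R : realType}.
Local Notation mu := (@lebesgue_measure R).
Local Notation Re := complex.Re.
Local Notation Im := complex.Im.
Implicit Types (b x y : R) (s z : R[i]).

Let shift1 : measurableTypeR R -> measurableTypeR R := fun y => (y : R) + 1.

Let measurable_shift1 : measurable_fun setT shift1.
Proof. exact: measurable_funD. Qed.

(** Translation invariance follows from uniqueness of the measure that gives half-open intervals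
    their length. *)
Let lebesgue_measure_shift (A : set R) : measurable A ->
  pushforward mu shift1 A = mu A.
Proof.
move=> mA; apply/esym/lebesgue_measure_unique => //= _ [[a b]] _ <-.
rewrite /pushforward.
have -> : shift1 @^-1` `]a, b] = `]a - 1, b - 1]%classic.
  by apply/seteqP; split => x /=; rewrite /shift1 !in_itv /= ltrBlDr lerBrDr.
rewrite !lebesgue_measure_itv/= !lte_fin ltrD2r.
by case: ifP => // _; rewrite -!EFinD opprB addrA subrK.
Qed.

Let preimage_shift1 : shift1 @^-1` `]1, +oo[ = `]0, +oo[%classic.
Proof.
by apply/seteqP; split => x /=; rewrite /shift1 !in_itv /= !andbT ltrDr.
Qed.

Lemma integrable_shift (f : R -> R) : measurable_fun setT f ->
  mu.-integrable `]0, +oo[ (fun y => (f (y + 1))%:E) ->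
  mu.-integrable `]1, +oo[ (EFin \o f).
Proof.
move=> mf; rewrite -preimage_shift1 => fi.
have H := @integrable_pushforward _ _ (measurableTypeR R) (measurableTypeR R) R
  shift1 measurable_shift1 mu `]1, +oo[%classic (EFin \o f)
  ((measurable_EFinP _ _).2 mf) fi (measurable_itv _).
apply/integrableP; move/integrableP : H => [mf' H]; split => //.
rewrite (eq_measure_integral (pushforward mu shift1))// => A mA _.
exact/esym/lebesgue_measure_shift.
Qed.

Lemma Rintegral_shift (f : R -> R) : measurable_fun setT f ->
  mu.-integrable `]0, +oo[ (fun y => (f (y + 1))%:E) ->
  \int[mu]_(x in `]1, +oo[) f x = \int[mu]_(y in `]0, +oo[) f (y + 1).
Proof.
move=> mf; rewrite /Rintegral -preimage_shift1 => fi.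
have H := @integral_pushforward _ _ (measurableTypeR R) (measurableTypeR R) R
  shift1 measurable_shift1 mu `]1, +oo[%classic (EFin \o f)
  ((measurable_EFinP _ _).2 mf) fi (measurable_itv _).
congr fine; rewrite -[RHS]H; apply: eq_measure_integral => A mA _.
exact/esym/lebesgue_measure_shift.
Qed.

Lemma integralC_shift (f : R -> R[i]) : cmeasurable f ->
  integrableC `]0, +oo[%classic (fun y => f (y + 1)) ->
  integrableC `]1, +oo[%classic f /\
  integralC `]1, +oo[%classic f = integralC `]0, +oo[%classic (fun y => f (y + 1)).
Proof.
move=> [rf jf] [ir ij]; split.
  by split; exact: integrable_shift.
by congr (_ +i* _); apply: Rintegral_shift.
Qed.

(** The Riemann-Liouville integrand at s of the function w |-> e^(-w). *)
Definition RL_kernel b s x : R[i] := expC (- s * x%:C) * gamma_kernel b (x - 1).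

Lemma cmeasurable_RL_kernel b s : cmeasurable (RL_kernel b s).
Proof.
apply: (@cmeasurable_laplace_kernel _ id (fun x => gamma_kernel b (x - 1))) => //.
apply: cmeasurable_real.
apply: (@measurableT_comp _ _ _ _ _ _ (fun y : R => y `^ (b - 1))).
  exact: measurable_powR.
exact: measurable_funB.
Qed.

Lemma RL_kernel_shift b s y : RL_kernel b s (y + 1) =
  expC (- s) * (expC (- s * y%:C) * gamma_kernel b y).
Proof.
rewrite /RL_kernel addrK rmorphD mulrDr mulr1 expCD; ring.
Qed.

Lemma integrable_RL_kernel b s : 0 < b -> 0 < Re s ->
  integrableC `]1, +oo[%classic (RL_kernel b s).
Proof.
move=> b0 s0; apply: (integralC_shift (cmeasurable_RL_kernel b s) _).1.
rewrite (funext (RL_kernel_shift b s)).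
apply: integrableCZ; first exact: measurable_itv.
exact: (laplace_integrable (laplace_weight_gamma b0) s0).
Qed.

(** In other words e^(-s) is a fixed point of the fractional integral: after x = y + 1 the factor
    e^(-s) comes out and the Gamma integral at s remains. *)
Lemma integral_RL_kernel b s : 0 < b -> 0 < Re s ->
  powC s b * integralC `]1, +oo[%classic (RL_kernel b s) =
  (Gamma b)%:C * expC (- s).
Proof.
move=> b0 s0.
have iG := laplace_integrable (laplace_weight_gamma b0) s0.
have mD := measurable_itv `]0, +oo[ : measurable (`]0, +oo[%classic : set R).
rewrite (integralC_shift (cmeasurable_RL_kernel b s) _).2; last first.
  by rewrite (funext (RL_kernel_shift b s)); exact: integrableCZ.
rewrite (funext (RL_kernel_shift b s)).
have -> := integralCZ mD (expC (- s)) iG.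
rewrite -/(laplace _ _ _ s) mulrCA (powC_gamma_laplace b0 s0).
exact: mulrC.
Qed.

(** On [1, 2] the integrand is at least e^(-2) min(1, 2^(b-1)): the minimum covers both signs of b -
    1, the power being monotone on this interval. *)
Lemma Gamma_gt0 b : 0 < b -> 0 < Gamma b.
Proof.
move=> b0; have W := laplace_weight_gamma b0.
have [_ _ _ _ /(_ 1 ltr01) ci] := W.
pose c : R := expR (- 2) * Num.min 1 (2 `^ (b - 1)).
have c0 : 0 < c by rewrite mulr_gt0 ?expR_gt0// lt_min ltr01 powR_gt0.
have ig : mu.-integrable `]0, +oo[ (fun t : R => (t `^ (b - 1) * expR (- t))%:E).
  move: ci; apply: eq_integrable => [|t]; first exact: measurable_itv.
  rewrite inE /= in_itv /= andbT => t0; rewrite mulN1r mulrC /gamma_kernel.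
  by rewrite absC_real ger0_norm// powR_ge0.
have sub : `[1, 2]%classic `<=` (`]0, +oo[%classic : set R).
  by move=> t /=; rewrite !in_itv /= andbT => /andP[h _]; exact: lt_le_trans h.
have iS : mu.-integrable `[1, 2] (fun t : R => (t `^ (b - 1) * expR (- t))%:E).
  apply: (@integrableS _ _ _ mu `]0, +oo[%classic _ _ _ _ sub ig);
    exact: measurable_itv.
apply: (@lt_le_trans _ _ (\int[mu]_(t in `[1, 2]) c)).
  rewrite Rintegral_cst; last exact: measurable_itv.
  rewrite (_ : fine _ = 1) ?mulr1// -[RHS]/(fine 1%:E); congr fine.
  apply: etrans (lebesgue_measure_itv `[1, 2]) _.
  by rewrite /= lte_fin ltr1n -EFinB; congr EFin; lra.
apply: (@le_trans _ _ (\int[mu]_(t in `[1, 2]) (t `^ (b - 1) * expR (- t)))).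
  apply: le_Rintegral => //.
  - apply: continuous_compact_integrable; first exact: segment_compact.
    by apply: continuous_subspaceT => x; exact: cvg_cst.
  - move=> t; rewrite /= in_itv /= => /andP[t1 t2]; rewrite /c mulrC ler_pM//.
    + have t0 : 0 < t by rewrite (lt_le_trans _ t1).
      rewrite ge_min; have [b1|b1] := leP 1 b.
        have e1 : 1 `^ (b - 1) = 1 :> R by rewrite powR1.
        by rewrite -[X in X <= _]e1 ge0_ler_powR ?nnegrE ?subr_ge0 ?(ltW t0).
      rewrite -[b - 1]opprB !powRN lef_pV2 ?posrE ?powR_gt0//.
      by rewrite ge0_ler_powR ?nnegrE ?(ltW t0) ?orbT// subr_ge0 ltW.
    + by rewrite ler_expR lerN2.
rewrite /Gamma /Rintegral fine_le//.
- exact: integrable_fin_num iS.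
- exact: integrable_fin_num ig.
apply: ge0_subset_integral => //.
- exact: measurable_int ig.
- by move=> t _; rewrite lee_fin mulr_ge0 ?powR_ge0 ?expR_ge0.
Qed.

End Shift.

Lemma complexR_neq0 (R : rcfType) (x : R) : (x%:C != 0 :> R[i]) = (x != 0).
Proof. by rewrite eq_complex /= eqxx andbT. Qed.

(** * The exchange of the fractional and Laplace integrals *)

Section RLLaplace.
Context {R : realType}.
Local Notation mu := (@lebesgue_measure R).
Local Notation Re := complex.Re.
Local Notation Im := complex.Im.
Variables (b : R) (D : set R) (c : R -> R) (phi : R -> R[i]) (z : R[i]).
Hypotheses (b0 : 0 < b) (W : laplace_weight D c phi).
Hypotheses (c1 : forall t, D t -> 1 <= c t) (z0 : 0 < Re z).
Local Notation A := (`]1, +oo[%classic : set R).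

Let mD : measurable D. Proof. by case: W. Qed.
Let mA : measurable A. Proof. exact: measurable_itv. Qed.
Let mc : measurable_fun setT c. Proof. by case: W. Qed.
Let mphi : cmeasurable phi. Proof. by case: W. Qed.

Let Phi (p : R * R) : R[i] := RL_kernel b (z * (c p.2)%:C) p.1 * phi p.2.

Let mPhi : cmeasurable (Phi : measurableTypeR R * measurableTypeR R -> R[i]).
Proof.
have m1 (h : R -> R) : measurable_fun setT h ->
    measurable_fun setT (fun p : measurableTypeR R * measurableTypeR R => h p.1).
  by move=> mh; exact: (measurableT_comp mh (measurable_fst)).
have m2 (h : R -> R) : measurable_fun setT h ->
    measurable_fun setT (fun p : measurableTypeR R * measurableTypeR R => h p.2).
  by move=> mh; exact: (measurableT_comp mh (measurable_snd)).
apply: cmeasurableM; last first.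
  by have [? ?] := mphi; split; exact: (m2 (fun t => _ (phi t))).
apply: cmeasurableM.
  apply: cmeasurable_expC; apply: cmeasurableM.
    have -> : (fun p : measurableTypeR R * measurableTypeR R => - (z * (c p.2)%:C)) =
      (fun p => (- z) * (c p.2)%:C) by apply/funext => p; rewrite mulNr.
    apply: cmeasurableM; first exact: cmeasurable_cst.
    by apply: cmeasurable_real; exact: m2.
  by apply: cmeasurable_real; exact: (m1 id).
apply: cmeasurable_real; apply: (m1 (fun x => (x - 1) `^ (b - 1))).
apply: (@measurableT_comp _ _ _ _ _ _ (fun y : R => y `^ (b - 1))).
  exact: measurable_powR.
exact: measurable_funB.
Qed.

Let zc0 t : D t -> 0 < Re (z * (c t)%:C).
Proof.
by move=> /c1 ct; rewrite !ReImE mulr0 subr0 mulr_gt0// (lt_le_trans _ ct).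
Qed.

Let zx0 x : A x -> 0 < Re (z * x%:C).
Proof.
rewrite /= in_itv /= andbT => x1.
by rewrite !ReImE mulr0 subr0 mulr_gt0// (lt_trans _ x1).
Qed.

(** The exponent z x c(t) is symmetric in x and c(t): for fixed t the integrand is a fractional
    kernel at z c(t), for fixed x a Laplace kernel at z x. The exchange of integrals passes from the
    second reading to the first. *)
Let PhiE x t : Phi (x, t) =
  gamma_kernel b (x - 1) * (expC (- (z * x%:C) * (c t)%:C) * phi t).
Proof.
rewrite /Phi /RL_kernel /= [RHS]mulrA; congr (_ * _).
by rewrite mulrC; congr (_ * expC _); ring.
Qed.

Let PhiA x : A x -> integrableC D (fun t => Phi (x, t)).
Proof.
move=> Ax; rewrite (funext (PhiE x)); apply: integrableCZ => //.
exact: laplace_integrable W (zx0 Ax).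
Qed.

Let PhiC t : (fun x => Phi (x, t)) = (fun x => phi t * RL_kernel b (z * (c t)%:C) x).
Proof. by apply/funext => x; rewrite /Phi mulrC. Qed.

Let PhiB t : D t -> integrableC A (fun x => Phi (x, t)).
Proof.
by move=> Dt; rewrite PhiC; apply: integrableCZ => //;
  exact: (integrable_RL_kernel b0 (zc0 Dt)).
Qed.

(** The integral over x of the modulus is Gamma(b) (Re z c)^(-b) e^(-Re z c) |phi|; c >= 1 allows
    c^(-b) to be dropped, which leaves a multiple of the Laplace majorant at Re z. *)
Let k t := Gamma b / Re z `^ b * (expR (- Re z * c t) * absC (phi t)).

Let ik : mu.-integrable D (EFin \o k).
Proof.
have [_ _ _ _ /(_ _ z0)] := W.
by move=> /(@integrableZl _ _ _ mu D mD (Gamma b / Re z `^ b)).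
Qed.

Let abs_RL_kernel s x : absC (RL_kernel b s x) =
  expR (- Re s * x) * (x - 1) `^ (b - 1).
Proof.
by rewrite absCM absC_expC absC_real ger0_norm ?powR_ge0// !ReImE mulr0 subr0.
Qed.

(** The modulus of the kernel at s is the kernel at Re s, so the exact formula at a positive real
    point evaluates it. *)
Let integral_abs_RL_kernel (s : R[i]) : 0 < Re s ->
  mu.-integrable A (fun x => (absC (RL_kernel b s x))%:E) /\
  \int[mu]_(x in A) absC (RL_kernel b s x) = Gamma b / Re s `^ b * expR (- Re s).
Proof.
move=> s0.
have E : RL_kernel b (Re s)%:C = (fun x => (absC (RL_kernel b s x))%:C).
  apply/funext => x; rewrite abs_RL_kernel /RL_kernel -rmorphN -rmorphM expC_real.
  by rewrite -rmorphM.
have s0' : 0 < Re (Re s)%:C by [].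
split; first by have := integrable_RL_kernel b0 s0'; rewrite E => -[].
have := integral_RL_kernel b0 s0'; rewrite E integralC_real//.
have -> : powC (Re s)%:C b = (Re s `^ b)%:C.
  rewrite /powC /lnC /argC absC_real (gtr0_norm s0) /= lexx divff ?gt_eqF//.
  by rewrite acos1 -[_ +i* 0]/(_%:C) -rmorphM expC_real /powR gt_eqF.
rewrite -rmorphN expC_real -!rmorphM => /complexI e.
by rewrite mulrAC -e mulrC mulKf// gt_eqF// powR_gt0.
Qed.

(** [P] stands for the real or the imaginary part, Fubini being available for real integrands. *)
Let fk (P : R[i] -> R) : (forall w, `|P w| <= absC w) ->
  (forall t, D t -> mu.-integrable A (fun x => (P (Phi (x, t)))%:E)) ->
  forall t, D t -> \int[mu]_(x in A) `|P (Phi (x, t))| <= k t.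
Proof.
move=> le iP t Dt; have [i1 i2] := integral_abs_RL_kernel (zc0 Dt).
apply: (@le_trans _ _ (\int[mu]_(x in A) (absC (phi t) *
    absC (RL_kernel b (z * (c t)%:C) x)))).
  apply: le_Rintegral => //.
  - exact: integrable_norm (iP _ Dt).
  - exact: (@integrableZl _ _ _ mu A mA _ _ i1).
  - by move=> x _; rewrite (le_trans (le _))// /Phi absCM mulrC.
rewrite RintegralZl// i2 /k mulrC mulrA.
rewrite ler_wpM2r ?absC_ge0//.
have -> : Re (z * (c t)%:C) = Re z * c t by rewrite !ReImE mulr0 subr0.
have ct := c1 Dt; have ct0 := lt_le_trans ltr01 ct.
rewrite mulNr ler_wpM2r ?expR_ge0// ler_wpM2l ?(ltW (Gamma_gt0 b0))//.
rewrite lef_pV2 ?posrE ?powR_gt0 ?mulr_gt0//.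
rewrite ge0_ler_powR ?nnegrE ?(ltW b0) ?(ltW z0)//.
  by rewrite mulr_ge0 ?(ltW z0) ?(ltW ct0).
by rewrite ler_peMr// ltW.
Qed.

Let Fub (P : R[i] -> R) (Ple : forall w, `|P w| <= absC w)
  (mP : measurable_fun setT
    (fun p : measurableTypeR R * measurableTypeR R => P (Phi p)))
  (iA : forall x, A x -> mu.-integrable D (fun t => (P (Phi (x, t)))%:E))
  (iB : forall t, D t -> mu.-integrable A (fun x => (P (Phi (x, t)))%:E)) :
  mu.-integrable A (fun x => (\int[mu]_(t in D) P (Phi (x, t)))%:E) /\
  \int[mu]_(x in A) \int[mu]_(t in D) P (Phi (x, t)) =
  \int[mu]_(t in D) \int[mu]_(x in A) P (Phi (x, t)).
Proof.
split.
  exact: (@integrable_Rintegral_Fubini _ _ (measurableTypeR R) (measurableTypeR R)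
    R mu mu A D mA mD (fun p => P (Phi p)) k mP iA iB ik (fk Ple iB)).
exact: (@Rintegral_Fubini _ _ (measurableTypeR R) (measurableTypeR R)
    R mu mu A D mA mD (fun p => P (Phi p)) k mP iA iB ik (fk Ple iB)).
Qed.

Let RL_integrandE x : A x ->
  RL_integrand b (laplace D c phi) z x = integralC D (fun t => Phi (x, t)).
Proof.
move=> Ax; rewrite (funext (PhiE x)) integralCZ//.
exact: laplace_integrable W (zx0 Ax).
Qed.

Lemma integrable_RL_laplace : integrableC A (RL_integrand b (laplace D c phi) z).
Proof.
have [mr mj] := mPhi.
have [ir _] := Fub (@ler_Re_absC R) mr (fun x h => (PhiA h).1) (fun x h => (PhiB h).1).
have [ij _] := Fub (@ler_Im_absC R) mj (fun x h => (PhiA h).2) (fun x h => (PhiB h).2).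
split.
  apply: eq_integrable ir => // x /[!inE] Ax.
  by rewrite RL_integrandE.
apply: eq_integrable ij => // x /[!inE] Ax.
by rewrite RL_integrandE.
Qed.

Lemma laplace_weight_powRN : laplace_weight D c (fun t => (c t `^ (- b))%:C * phi t).
Proof.
apply: (laplace_weight_le (M := 1) W).
  apply: cmeasurableM mphi; apply: cmeasurable_real.
  apply: (@measurableT_comp _ _ _ _ _ _ (fun y : R => y `^ (- b)) _ _ _ mc).
  exact: measurable_powR.
move=> t Dt; have ct := c1 Dt.
rewrite absCM absC_real ger0_norm ?powR_ge0// ler_wpM2r ?absC_ge0//.
rewrite powRN invf_le1 ?powR_gt0 ?(lt_le_trans ltr01)//.
by rewrite -[leLHS](powRr0 (c t)) ler_powR// ltW.
Qed.

Let powC_z_neq0 : powC z b != 0.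
Proof.
have := powR_gt0 b (absC_gt0 z0).
by rewrite -(absC_powC b z0); apply: contraTneq => ->; rewrite absC0 ltxx.
Qed.

Let Gamma_neq0 : (Gamma b)%:C != 0 :> R[i].
Proof. by rewrite complexR_neq0; exact: lt0r_neq0 (Gamma_gt0 b0). Qed.

Let integral_Phi t : D t -> integralC A (fun x => Phi (x, t)) =
  (Gamma b)%:C / powC z b * (expC (- z * (c t)%:C) * ((c t `^ (- b))%:C * phi t)).
Proof.
move=> Dt; have ct0 := lt_le_trans ltr01 (c1 Dt).
rewrite PhiC integralCZ//; last exact: integrable_RL_kernel b0 (zc0 Dt).
have := integral_RL_kernel b0 (zc0 Dt); rewrite mulrC.
rewrite [z * _]mulrC powCZ// powRN fmorphV => e.
have cb : (c t `^ b)%:C != 0 :> R[i].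
  by rewrite complexR_neq0; exact: lt0r_neq0 (powR_gt0 b ct0).
have -> : integralC A (RL_kernel b ((c t)%:C * z)) =
    (Gamma b)%:C * expC (- ((c t)%:C * z)) / ((c t `^ b)%:C * powC z b).
  by rewrite -e mulfK// mulf_neq0.
rewrite -mulrN [(c t)%:C * _]mulrC; field; rewrite powC_z_neq0 andbT; exact: cb.
Qed.

Let powC_Gamma_cancel (w : R[i]) :
  powC z b / (Gamma b)%:C * ((Gamma b)%:C / powC z b * w) = w.
Proof.
move: powC_z_neq0 Gamma_neq0; move: (powC z b) ((Gamma b)%:C) => p g p0 g0.
by rewrite mulrA mulf_div [p * _]mulrC divff ?mul1r// mulf_neq0.
Qed.

Lemma RL_laplace : RL b (laplace D c phi) z =
  laplace D c (fun t => (c t `^ (- b))%:C * phi t) z.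
Proof.
have [mr mj] := mPhi.
have [_ er] := Fub (@ler_Re_absC R) mr (fun x h => (PhiA h).1) (fun x h => (PhiB h).1).
have [_ ej] := Fub (@ler_Im_absC R) mj (fun x h => (PhiA h).2) (fun x h => (PhiB h).2).
have E : integralC A (RL_integrand b (laplace D c phi) z) =
    integralC D (fun t => integralC A (fun x => Phi (x, t))).
  rewrite (eq_integralC RL_integrandE); apply: complex_eqP; [exact: er|exact: ej].
rewrite /RL E (eq_integralC integral_Phi) (integralCZ mD).
  by rewrite powC_Gamma_cancel.
exact: laplace_integrable laplace_weight_powRN z0.
Qed.

End RLLaplace.

(** * The weight cosh ^ alpha *)

Section CoshWeight.
Context {R : realType}.
Local Notation mu := (@lebesgue_measure R).
Local Notation Re := complex.Re.
Local Notation Im := complex.Im.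
Implicit Types (a s t x y : R) (z nu : R[i]).

(** [K] integrates over [0, +oo[ while the fundamental theorem is set on ]0, +oo[; this lemma and
    the next two move between them, the endpoint being null. *)
Lemma integrable_itv_cbnd (f : R -> R) : measurable_fun setT f ->
  mu.-integrable `]0, +oo[ (EFin \o f) -> mu.-integrable `[0, +oo[ (EFin \o f).
Proof.
move=> mf /integrableP[_ fi]; apply/integrableP; split.
  by apply/measurable_EFinP; exact: measurable_funTS.
rewrite -integral_itv_obnd_cbnd//; apply: measurable_funTS.
by apply: measurableT_comp => //; exact/measurable_EFinP.
Qed.

Lemma integrableC_itv_obnd (f : R -> R[i]) : integrableC `[0, +oo[%classic f ->
  integrableC `]0, +oo[%classic f.
Proof.
have sub : `]0, +oo[%classic `<=` (`[0, +oo[%classic : set R).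
  by move=> t /=; rewrite !in_itv /= !andbT => /ltW.
move=> [fr fj]; split.
  apply: (@integrableS _ _ _ mu `[0, +oo[%classic _ _ _ _ sub fr);
    exact: measurable_itv.
apply: (@integrableS _ _ _ mu `[0, +oo[%classic _ _ _ _ sub fj);
  exact: measurable_itv.
Qed.

Lemma integralC_itv_obnd_cbnd (f : R -> R[i]) : integrableC `[0, +oo[%classic f ->
  integralC `[0, +oo[%classic f = integralC `]0, +oo[%classic f.
Proof.
move=> /integrableC_itv_obnd[fr fj].
by congr (_ +i* _); rewrite Rintegral_itv_obnd_cbnd.
Qed.

Lemma integrable_expRN : mu.-integrable `[0, +oo[ (fun t : R => (expR (- t))%:E).
Proof.
have m : measurable_fun setT (fun t : R => expR (- t)).
  by apply: measurableT_comp => //; exact: measurable_expR.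
apply: (integrable_itv_cbnd m).
apply: (@integrable_FTC _ (fun t => expR (- t)) (fun t => - expR (- t)) 1) => //.
- by move=> x _; apply: is_derive_eq; rewrite /GRing.scale /=; ring.
- move=> x _; apply: continuous_comp; first exact: opp_continuous.
  exact: continuous_expR.
- move=> x x0; rewrite normrN ger0_norm ?expR_ge0// -[leRHS]expR0.
  by rewrite ler_expR oppr_le0 ltW.
Qed.

Lemma coshR_ge1 t : 1 <= coshR t.
Proof.
rewrite /coshR ler_pdivlMr//.
have := expR_ge1Dx t; have := expR_ge1Dx (- t); lra.
Qed.

Lemma coshR_gt0 t : 0 < coshR t.
Proof. exact: lt_le_trans (coshR_ge1 t). Qed.

Definition sinhR t : R := (expR t - expR (- t)) / 2.

Lemma sinhR_sqr t : sinhR t ^+ 2 = coshR t ^+ 2 - 1.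
Proof.
rewrite /sinhR /coshR expRN; field.
by rewrite gt_eqF// expR_gt0.
Qed.

Lemma is_derive_coshR t : is_derive t (1 : R) coshR (sinhR t).
Proof.
rewrite /coshR /sinhR; apply: is_derive_eq; rewrite /GRing.scale /=; ring.
Qed.

Lemma is_derive_sinhR t : is_derive t (1 : R) sinhR (coshR t).
Proof.
rewrite /coshR /sinhR; apply: is_derive_eq; rewrite /GRing.scale /=; ring.
Qed.

Lemma measurable_coshR : measurable_fun setT (@coshR R).
Proof.
apply: measurable_funM => //; apply: measurable_funD; first exact: measurable_expR.
by apply: measurableT_comp => //; exact: measurable_expR.
Qed.

Definition coshpow a t := coshR t `^ a.

Lemma coshpow_ge1 a t : 0 < a -> 1 <= coshpow a t.
Proof.
move=> a0; rewrite /coshpow.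
have e1 : 1 `^ a = 1 :> R by rewrite powR1.
rewrite -[X in X <= _]e1 ge0_ler_powR ?nnegrE ?coshR_ge1 ?(ltW a0)//.
exact: ltW (coshR_gt0 t).
Qed.

Lemma measurable_coshpow a : measurable_fun setT (coshpow a).
Proof.
apply: (@measurableT_comp _ _ _ _ _ _ (fun y : R => y `^ a)).
  exact: measurable_powR.
exact: measurable_coshR.
Qed.

(** Quadratic growth of the weight is enough: cosh^a t >= 2^(-a) e^(a t) >= 2^(-a) (a t)^2 / 2, so s
    cosh^a t >= q t^2. The constant M is the maximum of e^((k+1) t - q t^2), found by completing the
    square; the + 1 in k + 1 pays for the target e^(-t). *)
Lemma coshpow_decay a s (k : R) : 0 < a -> 0 < s -> exists2 M : R, 0 <= M &
  forall t, 0 <= t -> expR (- s * coshpow a t) * expR (k * t) <= M * expR (- t).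
Proof.
move=> a0 s0; pose q := s * (2^-1 `^ a * (a ^+ 2 / 2)).
have q0 : 0 < q by rewrite !mulr_gt0 ?powR_gt0 ?invr_gt0 ?exprn_gt0.
exists (expR ((k + 1) ^+ 2 / (4 * q))); first exact: expR_ge0.
move=> t t0.
have h : q * t ^+ 2 <= s * coshpow a t.
  rewrite /q -mulrA ler_wpM2l ?(ltW s0)//.
  have le : 2^-1 * expR t <= coshR t.
    by rewrite /coshR mulrC ler_wpM2r// lerDl expR_ge0.
  apply: (@le_trans _ _ ((2^-1 * expR t) `^ a)); last first.
    by rewrite ge0_ler_powR ?nnegrE ?(ltW a0) ?mulr_ge0 ?expR_ge0 ?(ltW (coshR_gt0 t)).
  rewrite powRM ?expR_ge0// -mulrA ler_wpM2l ?powR_ge0// -expRM.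
  have := @expR_ge1Dxn _ (t * a) 1; rewrite mulr_ge0 ?(ltW a0)// => /(_ isT).
  rewrite -[2`!%:R]/(2%:R) exprMn; lra.
rewrite -!expRD ler_expR.
have sq : 0 <= (t - (k + 1) / (2 * q)) ^+ 2 * q by rewrite mulr_ge0 ?sqr_ge0 ?(ltW q0).
have e : (t - (k + 1) / (2 * q)) ^+ 2 * q = q * t ^+ 2 - (k + 1) * t +
   (k + 1) ^+ 2 / (4 * q) by field; rewrite gt_eqF.
rewrite {}e in sq; lra.
Qed.

Definition cosh_wave nu t : R[i] := coshC (nu * t%:C).
Definition sinh_wave nu t : R[i] := sinhC (nu * t%:C).

Lemma absC_cosh_wave nu t : 0 <= t -> absC (cosh_wave nu t) <= expR (`|Re nu| * t).
Proof.
move=> t0; rewrite (le_trans (absC_coshC_le _))// !ReImE mulr0 subr0.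
by rewrite normrM (ger0_norm t0).
Qed.

Lemma absC_sinh_wave nu t : 0 <= t -> absC (sinh_wave nu t) <= expR (`|Re nu| * t).
Proof.
move=> t0; rewrite (le_trans (absC_sinhC_le _))// !ReImE mulr0 subr0.
by rewrite normrM (ger0_norm t0).
Qed.

Let cderive_line nu t : cderive (fun y : R => nu * y%:C) t nu.
Proof.
apply: cderive_eq (cderiveZ nu (cderive_real (is_derive_id t 1))) _.
exact: mulr1.
Qed.

Let cderive_exp_line nu t : cderive (fun y : R => expC (nu * y%:C)) t
  (nu * expC (nu * t%:C)).
Proof. exact: cderive_expC (cderive_line nu t). Qed.

Let cosh_waveE nu : cosh_wave nu = fun t =>
  2^-1 * (expC (nu * t%:C) + expC (- nu * t%:C)).
Proof. by apply/funext => t; rewrite /cosh_wave /coshC mulNr mulrC. Qed.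

Let sinh_waveE nu : sinh_wave nu = fun t =>
  2^-1 * (expC (nu * t%:C) + -1 * expC (- nu * t%:C)).
Proof. by apply/funext => t; rewrite /sinh_wave /sinhC mulN1r mulNr mulrC. Qed.

Lemma cderive_cosh_wave nu t : cderive (cosh_wave nu) t (nu * sinh_wave nu t).
Proof.
rewrite cosh_waveE sinh_waveE.
apply: cderive_eq (cderiveZ _ (cderiveD (cderive_exp_line nu t)
  (cderive_exp_line (- nu) t))) _; ring.
Qed.

Lemma cderive_sinh_wave nu t : cderive (sinh_wave nu) t (nu * cosh_wave nu t).
Proof.
rewrite cosh_waveE sinh_waveE.
apply: cderive_eq (cderiveZ _ (cderiveD (cderive_exp_line nu t)
  (cderiveZ (-1) (cderive_exp_line (- nu) t)))) _; ring.
Qed.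

Lemma cmeasurable_cosh_wave nu : cmeasurable (cosh_wave nu).
Proof.
have m (k : R[i]) : cmeasurable (fun t : R => expC (k * t%:C)).
  apply: cmeasurable_expC; apply: cmeasurableM; first exact: cmeasurable_cst.
  exact: cmeasurable_real.
rewrite cosh_waveE; apply: cmeasurableM; first exact: cmeasurable_cst.
by apply: cmeasurableD; exact: m.
Qed.

Lemma laplace_weight_cosh a nu : 0 < a ->
  laplace_weight `[0, +oo[%classic (coshpow a) (cosh_wave nu).
Proof.
move=> a0; have mD := measurable_itv `[0, +oo[ : measurable (`[0, +oo[%classic : set R).
split => //.
- exact: measurable_coshpow.
- exact: cmeasurable_cosh_wave.
- by move=> x _; exact: powR_ge0.
move=> s s0; have [M M0 le] := coshpow_decay `|Re nu| a0 s0.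
apply: (le_integrable_real mD (h := fun t => M * expR (- t))).
- apply: measurable_funTS; apply: measurable_funM.
    apply: measurableT_comp; first exact: measurable_expR.
    by apply: measurable_funM => //; exact: measurable_coshpow.
  by apply: cmeasurable_absC; exact: cmeasurable_cosh_wave.
- move=> t; rewrite /= in_itv /= andbT => t0.
  rewrite ger0_norm ?mulr_ge0 ?expR_ge0 ?absC_ge0//.
  by rewrite (le_trans _ (le _ t0))// ler_wpM2l ?expR_ge0// absC_cosh_wave.
- exact: (@integrableZl _ _ _ mu _ mD M _ integrable_expRN).
Qed.

End CoshWeight.

Section CoshIdentity.
Context {R : realType}.
Local Notation mu := (@lebesgue_measure R).
Local Notation Re := complex.Re.
Local Notation Im := complex.Im.
Variables (a : R) (nu : R[i]).
Hypothesis a0 : 0 < a.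
Local Notation D := (`[0, +oo[%classic : set R).
Local Notation c := (coshpow a).

Definition sech2_wave (t : R) : R[i] := ((coshR t) ^- 2)%:C * cosh_wave nu t.
(** The weight tanh ^ 2, written as 1 - cosh ^ (-2) so that u - I u has it by linearity alone; the
    form tanh ^ 2 is restored only when the primitive is differentiated. *)
Definition tanh2_wave (t : R) : R[i] := cosh_wave nu t + -1 * sech2_wave t.

Let mD : measurable D. Proof. exact: measurable_itv. Qed.

Let W0 : laplace_weight D c (cosh_wave nu). Proof. exact: laplace_weight_cosh. Qed.

Lemma coshpow_powRN t : c t `^ (- (2 / a)) = (coshR t) ^- 2.
Proof.
rewrite /coshpow -powRrM (_ : a * - (2 / a) = - 2%:R); last by field; rewrite gt_eqF.
by rewrite powR_invn// ltW// coshR_gt0.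
Qed.

Lemma sech2_waveE :
  (fun t => (c t `^ (- (2 / a)))%:C * cosh_wave nu t) = sech2_wave.
Proof. by apply/funext => t; rewrite coshpow_powRN. Qed.

Let b0 : 0 < 2 / a. Proof. by rewrite divr_gt0. Qed.

Let c_ge1 t : D t -> 1 <= c t. Proof. by move=> _; exact: coshpow_ge1. Qed.

Lemma laplace_weight_sech2 : laplace_weight D c sech2_wave.
Proof. by rewrite -sech2_waveE; exact: laplace_weight_powRN W0 c_ge1. Qed.

Lemma laplace_weight_tanh2 : laplace_weight D c tanh2_wave.
Proof.
have [_ _ m _ _] := W0; have [_ _ ms _ _] := laplace_weight_sech2.
apply: (laplace_weight_le (M := 2) W0).
  apply: cmeasurableD => //; apply: cmeasurableM => //; exact: cmeasurable_cst.
move=> t _; rewrite (le_trans (absCD _ _))// mulN1r absCN mulrDl mul1r lerD2l.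
rewrite absCM absC_real ger0_norm ?invr_ge0 ?exprn_ge0 ?(ltW (coshR_gt0 t))//.
rewrite ler_piMl ?absC_ge0// invf_le1 ?exprn_gt0 ?coshR_gt0//.
by rewrite exprn_ege1// coshR_ge1.
Qed.

Let tanhR t : R := sinhR t / coshR t.

Let tanhR_sqr t : (coshR t) ^- 2 = 1 - tanhR t ^+ 2.
Proof.
rewrite /tanhR (expr_div_n (sinhR t)) sinhR_sqr; field.
by rewrite gt_eqF// coshR_gt0.
Qed.

Let is_derive_tanhR t : is_derive t (1 : R) tanhR ((coshR t) ^- 2).
Proof.
have h0 : coshR t != 0 by rewrite gt_eqF// coshR_gt0.
have D1 := is_derive_sinhR t.
have D2 := is_deriveV h0 (is_derive_coshR t).
have -> : (coshR t) ^- 2 = sinhR t *: (- (coshR t) ^- 2 *: sinhR t) +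
    (coshR t)^-1 *: coshR t; last exact: is_deriveM D1 D2.
have e : coshR t ^+ 2 - sinhR t ^+ 2 = 1 by rewrite sinhR_sqr; ring.
rewrite /GRing.scale /= -[LHS]mul1r -e; field.
exact: h0.
Qed.

Let is_derive_coshpow t : is_derive t (1 : R) c (a * (c t * tanhR t)).
Proof.
have D1 := is_derive1_powR a (coshR_gt0 t).
have D2 := is_derive_coshR t.
have D3 := is_derive1_comp D1 D2.
have -> : a * (c t * tanhR t) = a * coshR t `^ (a - 1) * sinhR t; last exact: D3.
rewrite /coshpow /tanhR -(mulr_powRB1 (ltW (coshR_gt0 t)) a0); field.
by rewrite gt_eqF// coshR_gt0.
Qed.

Section AtPoint.
Variable z : R[i].
Hypothesis z0 : 0 < Re z.

Let E t : R[i] := expC (- z * (c t)%:C).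

(** The integrand of the left side of the equation minus the right side, once z d/dz E = - z c E and
    its iterate z^2 c^2 E - z c E are inserted. *)
Let g t : R[i] :=
  (a ^+ 2)%:C * z ^+ 2 * (E t * ((c t)%:C * ((c t)%:C * tanh2_wave t))) +
  (- ((a ^+ 2)%:C * z) * (E t * ((c t)%:C * tanh2_wave t)) +
   (- nu ^+ 2 * (E t * cosh_wave nu t) +
    - (a%:C * z) * (E t * ((c t)%:C * sech2_wave t)))).

(* [H = E' cosh (nu t) - nu E sinh (nu t)], so [H' = (E'' - nu^2 E) cosh (nu t)]. *)
Let H t : R[i] := -1 * (E t *
  (z * a%:C * ((c t)%:C * ((tanhR t)%:C * cosh_wave nu t)) + nu * sinh_wave nu t)).

Let dE t : cderive E t (- z * (a * (c t * tanhR t))%:C * E t).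
Proof. exact: cderive_expC (cderiveZ _ (cderive_real (is_derive_coshpow t))). Qed.

Let dH t : cderive H t (g t).
Proof.
have dc := cderive_real (is_derive_coshpow t).
have dth := cderive_real (is_derive_tanhR t).
have dC := cderive_cosh_wave nu t; have dS := cderive_sinh_wave nu t.
apply: cderive_eq (cderiveZ _ (cderiveM (dE t) (cderiveD
  (cderiveZ _ (cderiveM dc (cderiveM dth dC))) (cderiveZ _ dS)))) _.
(* With cosh ^ (-2) replaced by 1 - tanh ^ 2, the claim is a polynomial identity in E, c, tanh and
   the two waves, which can then be treated as independent variables. *)
rewrite /g /tanh2_wave /sech2_wave tanhR_sqr.
move: (E t) (c t) (tanhR t) (cosh_wave nu t) (sinh_wave nu t) => e x h C S.
rewrite rmorphB rmorph1 !rmorphXn !rmorphM; ring.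
Qed.

(** Its value is immaterial: the derivative is there to make g continuous. *)
Let dg t : exists l, cderive g t l.
Proof.
have dc := cderive_real (is_derive_coshpow t).
have dC := cderive_cosh_wave nu t.
have h0 : coshR t ^+ 2 != 0 by rewrite expf_neq0// gt_eqF// coshR_gt0.
have [l dsech] : exists l, cderive sech2_wave t l.
  have D2 := is_derive_coshR t.
  have D1 : is_derive t (1 : R) (fun t => coshR t ^+ 2)
      (coshR t * sinhR t + coshR t * sinhR t).
    by apply: is_derive_eq; rewrite /GRing.scale /=; ring.
  have D3 := @is_deriveV _ (fun t : R => coshR t ^+ 2) t _ _ h0 D1.
  by eexists; apply: cderiveM dC; exact: cderive_real.
have dtanh := cderiveD dC (cderiveZ (-1) dsech).
have dEt := dE t.
eexists; apply: cderiveD.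
  apply: cderiveZ; apply: (cderiveM dEt); apply: (cderiveM dc).
  exact: (cderiveM dc dtanh).
apply: cderiveD.
  apply: cderiveZ; apply: (cderiveM dEt); exact: (cderiveM dc dtanh).
apply: cderiveD.
  apply: cderiveZ; exact: (cderiveM dEt dC).
apply: cderiveZ; apply: (cderiveM dEt); exact: (cderiveM dc dsech).
Qed.

(** Both terms of H vanish at 0, through tanh 0 = 0 and sinh 0 = 0, and H is differentiable there,
    so the one-sided limit comes from continuity. *)
Let H0 : absC (H x) @[x --> 0^'+] --> (0 : R).
Proof.
have [cr cj] := cderive_continuous (dH 0).
have H00 : H 0 = 0.
  have th0 : tanhR 0 = 0 by rewrite /tanhR /sinhR oppr0 subrr !mul0r.
  have S0 : sinh_wave nu 0 = 0.
    by rewrite /sinh_wave /sinhC rmorph0 mulr0 oppr0 subrr mul0r.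
  by rewrite /H th0 S0 rmorph0 mul0r !mulr0 addr0 !mulr0.
have C : `|Re (H x)| + `|Im (H x)| @[x --> (0 : R)] --> (0 : R).
  have C (P : R -> R) : {for (0 : R), continuous P} -> P 0 = 0 ->
      `|P x| @[x --> (0 : R)] --> (0 : R).
    by move=> /cvg_norm; rewrite /= => + P0; rewrite P0 normr0.
  rewrite -[X in _ --> X](addr0 0).
  by apply: cvgD; [apply: (C _ cr)|apply: (C _ cj)]; rewrite H00.
apply: squeeze_cvgr (cvg_cst 0) (cvg_at_right_filter C); near=> x.
by rewrite absC_ge0 absC_ler_ReIm.
Unshelve. all: by end_near. Qed.

Let Hy : absC (H x) @[x --> +oo%R] --> (0 : R).
Proof.
have s2 : 0 < Re z / 2 by rewrite divr_gt0.
have [M M0 le] := coshpow_decay `|Re nu| a0 s2.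
(* One half of e^(-Re z c) bounds the factor c coming from E', by c e^(-Re z c / 2) <= 2 / Re z;
   this gives the first term of B. The other half beats the growth e^(|Re nu| x) of the waves. *)
pose B := absC z * a * (Re z / 2)^-1 + absC nu.
have C : B * M * expR (- 1 * x) @[x --> +oo%R] --> (0 : R).
  rewrite -[X in _ --> X](mulr0 (B * M)); apply: cvgM; first exact: cvg_cst.
  exact: cvg_expR_decay.
apply: squeeze_cvgr (cvg_cst 0) C; near=> x.
have x0 : 0 <= x by near: x; exact: nbhs_pinfty_ge.
rewrite absC_ge0 /= -mulrA mulN1r.
have B0 : 0 <= B.
  by rewrite addr_ge0 ?absC_ge0// !mulr_ge0 ?absC_ge0 ?invr_ge0 ?(ltW a0) ?(ltW s2).
apply: le_trans (ler_wpM2l B0 (le _ x0)).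
have th1 : `|tanhR x| <= 1.
  rewrite -(expr_le1 (_ : 0 < 2)%N)// -normrX ger0_norm ?sqr_ge0//.
  rewrite -subr_ge0 -tanhR_sqr invr_ge0 exprn_ge0// ltW// coshR_gt0//.
have c0 : 0 <= c x by exact: powR_ge0.
rewrite /H mulN1r absCN absCM absC_expC !ReImE mulr0 subr0.
set e2 := expR (- (Re z / 2) * c x); set k := expR (`|Re nu| * x).
have E2 : expR (- Re z * c x) = e2 * e2 by rewrite -expRD; congr expR; field.
have e21 : e2 <= 1.
  by rewrite -[leRHS]expR0 ler_expR mulNr oppr_le0 mulr_ge0 ?(ltW s2).
have e20 : 0 <= e2 by exact: expR_ge0.
have ce2 : e2 * c x <= (Re z / 2)^-1.
  rewrite /e2 mulNr expRN ler_pdivrMl ?expR_gt0// -ler_pdivrMr ?invr_gt0// invrK.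
  by rewrite mulrC (le_trans _ (expR_ge1Dx _))// lerDr.
rewrite E2 -mulrA [leRHS]mulrCA ler_wpM2l//.
apply: (@le_trans _ _ (e2 * (absC z * a * c x * k + absC nu * k))).
  rewrite ler_wpM2l// (le_trans (absCD _ _))// lerD//.
    rewrite (absCM (z * a%:C)) (absCM z) (absCM (c x)%:C) (absCM (tanhR x)%:C).
    rewrite !absC_real (gtr0_norm a0) (ger0_norm c0) [leLHS]mulrA.
    rewrite ler_wpM2l ?mulr_ge0 ?absC_ge0 ?(ltW a0)//.
    by rewrite -[leRHS]mul1r ler_pM ?absC_ge0//; exact: absC_cosh_wave.
  by rewrite (absCM nu) ler_wpM2l ?absC_ge0//; exact: absC_sinh_wave.
have -> : e2 * (absC z * a * c x * k + absC nu * k) =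
    (absC z * a * (e2 * c x) + e2 * absC nu) * k by ring.
rewrite ler_wpM2r ?expR_ge0// lerD//.
  by rewrite ler_wpM2l ?mulr_ge0 ?absC_ge0 ?(ltW a0).
by rewrite ler_piMl ?absC_ge0.
Unshelve. all: by end_near. Qed.

(** The equation with all derivatives carried out, each d/dz having brought a factor -c into the
    weight. It is the vanishing of the integral of g = H', as H tends to 0 at both ends. *)
Lemma laplace_cosh_identity :
  (a ^+ 2)%:C * (z * (- laplace D c (fun t => (c t)%:C * tanh2_wave t) z +
    z * laplace D c (fun t => (c t)%:C * ((c t)%:C * tanh2_wave t)) z)) =
  nu ^+ 2 * laplace D c (cosh_wave nu) z -
  a%:C * (z * - laplace D c (fun t => (c t)%:C * sech2_wave t) z).
Proof.
have Ww := laplace_weight_tanh2; have W1 := laplace_weight_mul Ww.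
have W2 := laplace_weight_mul W1; have Ws := laplace_weight_mul laplace_weight_sech2.
have i2 := laplace_integrable W2 z0; have i1 := laplace_integrable W1 z0.
have i0 := laplace_integrable W0 z0; have is' := laplace_integrable Ws z0.
have j2 := integrableCZ mD ((a ^+ 2)%:C * z ^+ 2) i2.
have j1 := integrableCZ mD (- ((a ^+ 2)%:C * z)) i1.
have j0 := integrableCZ mD (- nu ^+ 2) i0.
have js := integrableCZ mD (- (a%:C * z)) is'.
have j0s := integrableCD mD j0 js; have j10s := integrableCD mD j1 j0s.
have ig : integrableC D g := integrableCD mD j2 j10s.
have mg : cmeasurable g.
  have [_ mc m0 _ _] := W0; have [_ _ m2 _ _] := W2; have [_ _ m1 _ _] := W1.
  have [_ _ ms _ _] := Ws.
  have mk phi : cmeasurable phi ->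
      forall k : R[i], cmeasurable (fun t => k * (E t * phi t)).
    move=> mp k; apply: cmeasurableM; first exact: cmeasurable_cst.
    exact: cmeasurable_laplace_kernel mc mp.
  by apply: cmeasurableD (mk _ m2 _) _; apply: cmeasurableD (mk _ m1 _) _;
    apply: cmeasurableD (mk _ m0 _) (mk _ ms _).
have I0 : integralC D g = 0.
  rewrite (integralC_itv_obnd_cbnd ig).
  exact: (integralC_FTC (fun t _ => dH t) (fun t _ => dg t) mg
    (integrableC_itv_obnd ig) H0 Hy).
have e : integralC D g =
    (a ^+ 2)%:C * z ^+ 2 *
      laplace D c (fun t => (c t)%:C * ((c t)%:C * tanh2_wave t)) z +
    (- ((a ^+ 2)%:C * z) * laplace D c (fun t => (c t)%:C * tanh2_wave t) z +
     (- nu ^+ 2 * laplace D c (cosh_wave nu) z +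
      - (a%:C * z) * laplace D c (fun t => (c t)%:C * sech2_wave t) z)).
  rewrite (integralCD mD j2 j10s) (integralCD mD j1 j0s) (integralCD mD j0 js).
  by rewrite (integralCZ mD _ i2) (integralCZ mD _ i1) (integralCZ mD _ i0)
    (integralCZ mD _ is').
rewrite I0 in e; apply/eqP; rewrite -subr_eq0; apply/eqP; rewrite {}[RHS]e; ring.
Qed.

End AtPoint.
End CoshIdentity.

(** The Laplace formulas for I u, u - I u and its image under z d/dz hold on the half-plane only;
    openness lets derivatives be computed on the formulas instead. *)
Lemma near_halfplane (R : realType) (z : R[i]) : 0 < complex.Re z ->
  \forall s \near (z : R[i]^o), 0 < complex.Re s.
Proof.
move=> z0; apply/nbhs_ballP; exists (complex.Re z)%:C; first by rewrite /= ltcR.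
move=> s; rewrite -ball_normE /= normC_absC ltcR => zs.
have := ler_Re_absC (z - s); rewrite Re_add Re_opp ler_norml => /andP[_].
lra.
Qed.

Theorem theorem1 (R : realType) (alpha : R) (nu : R[i]) (alpha_gt0 : 0 < alpha)
    (z : R[i]) (z_gt0 : 0 < complex.Re z) :
  let u : R[i] -> R[i] := K alpha nu in
  let Iu : R[i] -> R[i] := RL (2 / alpha) u in
  let w : R[i] -> R[i] := fun s => u s - Iu s in
  (* all the integrals and derivatives in the equation exist *)
  [/\ integrableC `[0, +oo[%classic (K_integrand alpha nu z),
      integrableC `]1, +oo[%classic (RL_integrand (2 / alpha) u z),
      differentiableC Iu z,
      differentiableC w z & differentiableC (zD w) z] /\
  (alpha ^+ 2)%:C * zD (zD w) z = nu ^+ 2 * u z - alpha%:C * zD Iu z.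
Proof.
set D : set R := `[0, +oo[%classic.
pose c := coshpow alpha; pose L := laplace D c.
pose Ls := L (fun t => (c t)%:C * sech2_wave nu t).
pose Lw := L (fun t => (c t)%:C * tanh2_wave nu t).
pose Lww := L (fun t => (c t)%:C * ((c t)%:C * tanh2_wave nu t)).
have uE : K alpha nu = L (cosh_wave nu) by [].
rewrite uE; move=> u Iu w.
have W0 := laplace_weight_cosh nu alpha_gt0.
have Ws := laplace_weight_sech2 nu alpha_gt0.
have Ww := laplace_weight_tanh2 nu alpha_gt0.
have Ww1 := laplace_weight_mul Ww.
have b0 : 0 < 2 / alpha by rewrite divr_gt0.
have c1 t : D t -> 1 <= c t by move=> _; exact: coshpow_ge1.
have IuE s : 0 < complex.Re s -> Iu s = L (sech2_wave nu) s.
  by move=> s0; rewrite /Iu /u (RL_laplace b0 W0 c1 s0) (sech2_waveE nu alpha_gt0).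
have wE s : 0 < complex.Re s -> w s = L (tanh2_wave nu) s.
  move=> s0; rewrite /w IuE// /u /L /laplace.
  have i0 := laplace_integrable W0 s0; have is' := laplace_integrable Ws s0.
  have mD : measurable D by exact: measurable_itv.
  rewrite -[- integralC _ _]mulN1r -(integralCZ mD _ is').
  rewrite -(integralCD mD i0 (integrableCZ mD _ is')).
  by apply: eq_integralC => t _; rewrite /tanh2_wave; ring.
have dIu : is_derive (z : R[i]^o) 1 (Iu : R[i]^o -> R[i]^o) (- Ls z : R[i]^o).
  apply: near_eq_is_derive (is_derive_laplace Ws z_gt0).
  by apply: filterS (near_halfplane z_gt0) => s /IuE ->.
(* Proved at every s of the half-plane, not just at z, because the resulting function z d/dz w is to
   be differentiated once more. *)
have dw s : 0 < complex.Re s ->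
    is_derive (s : R[i]^o) 1 (w : R[i]^o -> R[i]^o) (- Lw s : R[i]^o).
  move=> s0; apply: near_eq_is_derive (is_derive_laplace Ww s0).
  by apply: filterS (near_halfplane s0) => y /wE ->.
have zwE s : 0 < complex.Re s -> zD w s = s * - Lw s.
  by move=> s0; rewrite /zD; have [_ ->] := dw _ s0.
have dzw : is_derive (z : R[i]^o) 1 (zD w : R[i]^o -> R[i]^o)
    (- Lw z + z * Lww z : R[i]^o).
  have dL := is_deriveN (is_derive_laplace Ww1 z_gt0).
  have dM := is_deriveM (is_derive_id (z : R[i]^o) (1 : R[i]^o)) dL.
  apply: (@near_eq_is_derive _ _ _ (fun s : R[i]^o => s * - Lw s : R[i]^o)).
    by apply: filterS (near_halfplane z_gt0) => s /zwE ->.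
  have -> : - Lw z + z * Lww z =
      z *: (- - Lww z : R[i]^o) + (- Lw z : R[i]^o) *: (1 : R[i]^o).
    by rewrite opprK [_ *: 1]mulr1 addrC.
  exact: dM.
split.
  split.
  - exact: laplace_integrable W0 z_gt0.
  - exact: integrable_RL_laplace b0 W0 c1 z_gt0.
  - by case: dIu.
  - by case: (dw _ z_gt0).
  - by case: dzw.
have -> : zD (zD w) z = z * (- Lw z + z * Lww z).
  by rewrite {1}/zD; have [_ ->] := dzw.
have -> : zD Iu z = z * - Ls z.
  by rewrite /zD; have [_ ->] := dIu.
exact: (laplace_cosh_identity nu alpha_gt0 z_gt0).
Qed.
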